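(* Let $R$ be a non-primitive Dedekind prime ring and let $M$ be a right $R$-module. The following conditions are equivalent: (1) $M$ is super Bassian. (2) There exists a finitely generated non-singular submodule $H$ of $M$ such that $M/H$ is singular and all primary components of $M/H$ are Noetherian. (3) There exists a finitely generated submodule $H$ of $M$ such that $M/H$ is singular and all primary components of $M/H$ are finitely generated.
   Context: Rings are associative with identity and modules are unital right modules. A module $M$ is Bassian if, for every submodule $N$ of $M$, the existence of a monomorphism $M\to M/N$ forces $N=0$. A module $M$ is super Bassian if every epimorphic image (equivalently every quotient module) of $M$ is Bassian. $\mathrm{Sing}(M)$ denotes the singular submodule of $M$, i.e. the set of $m\in M$ whose right annihilator in $R$ is an essential right ideal; $M$ is singular if $\mathrm{Sing}(M)=M$ and non-singular if $\mathrm{Sing}(M)=0$. An HNP ring is a hereditary Noetherian prime ring (on both sides). A ring is non-primitive if it has no faithful simple right module and no faithful simple left module. A Dedekind prime ring is an HNP ring, with classical ring of fractions $Q$, in which every non-zero two-sided ideal is invertible in $Q$ (an ideal $I$ is invertible if $IJ=JI=R$ for some $R$-sub-bimodule $J$ of $Q$). A maximal invertible ideal is an ideal maximal among the proper invertible ideals of $R$. For a maximal invertible ideal $P$, the $P$-primary component of a module $X$ is $X(P)=\{x\in X : xP^n=0 \text{ for some } n\ge 1\}$; the primary components of $X$ are the submodules $X(P)$ with $P$ ranging over all maximal invertible ideals of $R$. *)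

(* Defs.v *)
From HB Require Import structures.
From mathcomp Require Import all_boot all_order all_algebra generic_quotient.
From mathcomp Require Import ring_quotient.
From mathcomp Require Import boolp classical_sets.

Set Implicit Arguments.
Unset Strict Implicit.
Unset Printing Implicit Defensive.

Import GRing.Theory.
Local Open Scope ring_scope.
Local Open Scope quotient_scope.
Local Open Scope classical_set_scope.

(* An [lmodType S] is a left S-module, so a right R-module is an
   [lmodType R^c], the action m r being [(r : R^c) *: m]. The notions below are
   stated for left S-modules; at S := R^c they are the corresponding notions
   for right R-modules, and the left ideals of R^c (the submodules of R^c^o)
   are the right ideals of R. *)

Set Warnings "-redundant-canonical-projection,-projection-no-head-constant".

Section Submodules.
Variables (S : nzRingType) (M : lmodType S) (N : submodClosed M).

Definition submodule : Type := {x : M | x \in N}.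

HB.instance Definition _ := SubChoice.on submodule.
HB.instance Definition _ := [SubChoice_isSubLmodule of submodule by <:].

Definition submod_zmod : {pred M} := fun x => x \in N.

Fact submod_zmodP : zmod_closed submod_zmod.
Proof.
split=> [|x y Nx Ny]; first exact: (rpred0 N).
by rewrite -[_ - _]/(x - y) -scaleN1r; apply: (@rpredD _ N) => //; apply: rpredZ.
Qed.

HB.instance Definition _ := GRing.isZmodClosed.Build M submod_zmod submod_zmodP.

Definition quotient_module : Type := Quotient.quot submod_zmod.

HB.instance Definition _ := GRing.Zmodule.on quotient_module.
HB.instance Definition _ := EqQuotient.on quotient_module.

Definition quotient_scale (a : S) (x : quotient_module) : quotient_module :=
  \pi_quotient_module (a *: repr x).

Fact pi_scale (a : S) (x : M) :
  \pi_quotient_module (a *: x) = quotient_scale a (\pi_quotient_module x).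
Proof.
rewrite /quotient_scale; apply/eqP; rewrite -(Quotient.idealrBE submod_zmod).
rewrite -scalerBr; apply: (@rpredZ _ _ N).
rewrite -[_ \in _]/(_ \in submod_zmod) (Quotient.idealrBE submod_zmod).
by rewrite reprK.
Qed.

Fact pi_add (x y : M) :
  \pi_quotient_module (x + y) = \pi_quotient_module x + \pi_quotient_module y.
Proof. exact: (Quotient.pi_add submod_zmod). Qed.

Fact quotient_ind (P : quotient_module -> Prop) :
  (forall x, P (\pi_quotient_module x)) -> forall x, P x.
Proof. by move=> Ppi x; rewrite -[x]reprK. Qed.

Fact quotient_scaleA a b x :
  quotient_scale a (quotient_scale b x) = quotient_scale (a * b) x.
Proof. by elim/quotient_ind: x => x; rewrite -!pi_scale scalerA. Qed.

Fact quotient_scale1 : left_id 1 quotient_scale.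
Proof. by elim/quotient_ind=> x; rewrite -pi_scale scale1r. Qed.

Fact quotient_scaleDr : right_distributive quotient_scale +%R.
Proof.
move=> a; elim/quotient_ind=> x; elim/quotient_ind=> y.
by rewrite -pi_add -!pi_scale -pi_add scalerDr.
Qed.

Fact quotient_scaleDl x : {morph quotient_scale^~ x : a b / a + b}.
Proof.
by move=> a b; elim/quotient_ind: x => x; rewrite -!pi_scale -pi_add scalerDl.
Qed.

HB.instance Definition _ := GRing.Zmodule_isLmodule.Build S quotient_module
  quotient_scaleA quotient_scale1 quotient_scaleDr quotient_scaleDl.

End Submodules.

Section ModuleNotions.
Variable S : nzRingType.
Implicit Type M : lmodType S.

Definition zero_submodule M (N : submodClosed M) : Prop :=
  forall x, x \in N -> x = 0.

Definition finitely_generated M : Prop :=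
  exists (n : nat) (e : 'I_n -> M),
    forall x, exists c : 'I_n -> S, x = \sum_i c i *: e i.

Definition noetherian M : Prop :=
  forall N : nat -> submodClosed M,
    (forall i, {subset N i <= N i.+1}) ->
    exists n, forall m, (n <= m)%N -> N m =i N n.

Definition simple_module M : Prop :=
  (exists x : M, x != 0) /\
  forall N : submodClosed M, zero_submodule N \/ (forall x, x \in N).

Definition faithful M : Prop :=
  forall r : S, (forall x : M, r *: x = 0) -> r = 0.

Definition projective M : Prop :=
  forall (A B : lmodType S) (g : {linear A -> B}) (f : {linear M -> B}),
    (forall b, exists a, g a = b) ->
    exists h : {linear M -> A}, forall x, g (h x) = f x.

Definition left_hereditary : Prop :=
  forall I : submodClosed S^o, projective (submodule I).

Definition essential_ideal (E : set S) : Prop :=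
  forall I : submodClosed S^o, ~ zero_submodule I ->
    exists r : S, [/\ r \in I, r != 0 & E r].

Definition Sing M : set M :=
  [set x | essential_ideal [set r : S | r *: x = 0]].

Arguments Sing M : clear implicits.

Definition singular M : Prop := Sing M = setT.

Definition non_singular M : Prop := Sing M = [set 0].

Definition bassian M : Prop :=
  forall N : submodClosed M,
    (exists f : {linear M -> quotient_module N}, injective f) -> zero_submodule N.

Definition super_bassian M : Prop :=
  forall (M' : lmodType S) (p : {linear M -> M'}),
    (forall y, exists x, p x = y) -> bassian M'.

End ModuleNotions.

Arguments Sing {S} M.

(* Product of additive subgroups: finite sums of products. *)
Definition mul_set (T : nzRingType) (A B : set T) : set T :=
  [set x | exists s : seq (T * T),
     (forall p, p \in s -> A p.1 /\ B p.2) /\ x = \sum_(p <- s) p.1 * p.2].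

Record ideal (R : nzRingType) := Ideal {
  ideal_pred :> {pred R};
  ideal_left : submod_closed (ideal_pred : {pred R^o});
  ideal_right : submod_closed (ideal_pred : {pred R^c^o}) }.

Definition ideal_set (R : nzRingType) (I : ideal R) : set R := [set r | r \in I].

Fixpoint ideal_pow (R : nzRingType) (I : ideal R) (n : nat) : set R :=
  if n is k.+1 then mul_set (ideal_pow I k) (ideal_set I) else setT.

Section IdealPow.
Variables (R : nzRingType) (I : ideal R).

Lemma ideal_mull r x : x \in I -> r * x \in I.
Proof.
by case: (ideal_left I) => I0 Il Ix; have := Il r x 0 Ix I0; rewrite addr0.
Qed.

Lemma ideal_mulr x r : x \in I -> x * r \in I.
Proof.
by case: (ideal_right I) => I0 Ir Ix; have := Ir r x 0 Ix I0; rewrite addr0.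
Qed.

Lemma ideal_powMl n r x : ideal_pow I n x -> ideal_pow I n (r * x).
Proof.
elim: n r x => [//|n IHn] r x /= [s [sP ->]].
exists [seq (r * p.1, p.2) | p <- s]; split=> [_ /mapP[p /sP[p1 p2] ->]|].
  by split=> //; apply: IHn.
by rewrite big_map mulr_sumr; apply: eq_bigr => p _; rewrite mulrA.
Qed.

Lemma ideal_powMr n x r : ideal_pow I n x -> ideal_pow I n (x * r).
Proof.
case: n => [//|n] /= [s [sP ->]].
exists [seq (p.1, p.2 * r) | p <- s]; split=> [_ /mapP[p /sP[p1 p2] ->]|].
  by split=> //; apply: ideal_mulr.
by rewrite big_map mulr_suml; apply: eq_bigr => p _; rewrite mulrA.
Qed.

Lemma ideal_pow0 n : ideal_pow I n 0.
Proof. by case: n => [//|n]; exists [::]; rewrite big_nil. Qed.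

Lemma ideal_powD n x y :
  ideal_pow I n x -> ideal_pow I n y -> ideal_pow I n (x + y).
Proof.
case: n => [//|n] /= [s [sP ->]] [t [tP ->]].
exists (s ++ t); rewrite big_cat; split=> // p.
by rewrite mem_cat => /orP[/sP|/tP].
Qed.

Lemma ideal_powS n x : ideal_pow I n.+1 x -> ideal_pow I n x.
Proof.
case=> s [sP ->]; elim: s sP => [|p s IHs] sP.
  by rewrite big_nil; apply: ideal_pow0.
rewrite big_cons; apply: ideal_powD.
  by apply: ideal_powMr; have [] := sP p (mem_head _ _).
by apply: IHs => q qs; apply: sP; rewrite in_cons qs orbT.
Qed.

Lemma ideal_pow_le m n x : (m <= n)%N -> ideal_pow I n x -> ideal_pow I m x.
Proof.
move/subnK<-; elim: (n - m)%N => [//|k IHk] /= In.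
exact/IHk/ideal_powS.
Qed.

End IdealPow.

Section PrimaryComponent.
Variables (R : nzRingType) (P : ideal R) (X : lmodType R^c).

Definition primary_component : {pred X} :=
  fun x => `[< exists n : nat, (0 < n)%N /\
                 forall r : R, ideal_pow P n r -> (r : R^c) *: x = 0 >].

Fact primary_component_closed : submod_closed primary_component.
Proof.
split=> [|a x y /asboolP[m [m0 Px]] /asboolP[n [n0 Py]]]; apply/asboolP.
  by exists 1%N; split=> // r _; rewrite scaler0.
exists (m + n)%N; split=> [|r Pr]; first by rewrite addn_gt0 m0.
rewrite scalerDr scalerA [X in _ + X]Py ?addr0; last first.
  by apply: ideal_pow_le Pr; rewrite leq_addl.
apply: (Px ((a : R) * r)); apply: ideal_powMl.
by apply: ideal_pow_le Pr; rewrite leq_addr.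
Qed.

HB.instance Definition _ :=
  GRing.isSubmodClosed.Build R^c X primary_component primary_component_closed.

End PrimaryComponent.

Arguments primary_component {R} P X.

Section RingNotions.
Variable R : nzRingType.

Definition zero_ideal (I : ideal R) : Prop := forall r, r \in I -> r = 0.

Definition prime_ring : Prop :=
  forall I J : ideal R, mul_set (ideal_set I) (ideal_set J) `<=` [set 0] ->
    zero_ideal I \/ zero_ideal J.

Definition hnp_ring : Prop :=
  [/\ left_hereditary R^c /\ left_hereditary R,
      noetherian R^c^o /\ noetherian R^o
    & prime_ring].

Definition non_primitive : Prop :=
  (~ exists V : lmodType R^c, simple_module V /\ faithful V) /\
  (~ exists V : lmodType R, simple_module V /\ faithful V).

Definition regular_elt (s : R) : Prop := GRing.lreg s /\ GRing.rreg s.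

End RingNotions.

Section Fractions.
Variables (R : nzRingType) (Q : unitRingType) (iota : {rmorphism R -> Q}).

Definition classical_ring_of_fractions : Prop :=
  [/\ injective iota,
      forall s, regular_elt s -> iota s \is a GRing.unit,
      forall q, exists a s, regular_elt s /\ q = iota a * (iota s)^-1
    & forall q, exists a s, regular_elt s /\ q = (iota s)^-1 * iota a].

Definition sub_bimodule (J : set Q) : Prop :=
  [/\ J 0,
      forall x y, J x -> J y -> J (x - y),
      forall r x, J x -> J (iota r * x)
    & forall r x, J x -> J (x * iota r)].

Definition invertible_ideal (I : ideal R) : Prop :=
  exists J : set Q, [/\ sub_bimodule J,
    mul_set (iota @` ideal_set I) J = range iota
    & mul_set J (iota @` ideal_set I) = range iota].

Definition proper_invertible_ideal (I : ideal R) : Prop :=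
  invertible_ideal I /\ ideal_set I <> setT.

Definition maximal_invertible_ideal (P : ideal R) : Prop :=
  proper_invertible_ideal P /\
  forall P' : ideal R, proper_invertible_ideal P' ->
    {subset P <= P'} -> P' =i P.

(* The classical ring of fractions is unique up to isomorphism over R, so it is
   given by an embedding iota rather than constructed. *)
Definition dedekind_prime_ring : Prop :=
  [/\ hnp_ring R, classical_ring_of_fractions
    & forall I : ideal R, ~ zero_ideal I -> invertible_ideal I].

Definition all_primary_components (C : lmodType R^c -> Prop)
    (X : lmodType R^c) : Prop :=
  forall P : ideal R, maximal_invertible_ideal P ->
    C (@submodule R^c X (primary_component P X)).

End Fractions.

(* Main.v *)
Require Import Defs.
From HB Require Import structures.
From mathcomp Require Import all_boot all_order all_algebra generic_quotient.
From mathcomp Require Import ring_quotient.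
From mathcomp Require Import boolp classical_sets.

Set Implicit Arguments.
Unset Strict Implicit.
Unset Printing Implicit Defensive.

Import GRing.Theory.
Local Open Scope ring_scope.
Local Open Scope quotient_scope.
Local Open Scope classical_set_scope.

(** Two finiteness properties of [M] are involved. The torsion-free part of [M]
is controlled by a finitely generated [H] over which [M] is torsion, and the
torsion part is controlled by primary components, one for each maximal ideal
[P]. Everything rests on one property of the ring: every essential right ideal
contains a nonzero two-sided ideal ([essential_bounded]). The reason is that
the right ideals above an essential one satisfy the descending chain condition
([right_ideal_dcc], by duality between right and left ideals of a hereditary
ring), so that a counterexample has a simple extension, and simple modules are
annihilated by nonzero ideals because the ring is non-primitive. Hence an
element is singular exactly when it is annihilated by a nonzero ideal [I], and
invertibility of ideals splits it into a part annihilated by a power of [P] and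
a part annihilated by an ideal comaximal with [P] ([coprime_right],
[coprime_left], [torsion_split_right], [torsion_split_left]).

From the finiteness conditions to super Bassian. The conditions pass to
quotients ([primary_noetherian_image]), so it is enough to prove that [M] is
Bassian ([primary_noetherian_bassian]). An embedding [f] of [M] in [M / N] yields
the submodules [C 0 = 0], [C (k + 1) = pi^-1 (f (C k))], which increase with [k];
if they become stationary, then injectivity of [f] forces [C 1 = C 0], that is
[N = 0]. With each term replaced by its torsion closure, the chain stops,
because a submodule [K] with [M / K] torsion-free is determined by its
intersection with the noetherian module [H]; this shows that [N] is torsion.
Applied inside a [P]-primary component, the argument shows that [N] has zero
[P]-primary component, for all [P].

From super Bassian to the finiteness conditions. The core is that a [P]-primary
super Bassian module [Y] is noetherian ([primary_super_bassian_acc]). First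
[Y / YP] is a semisimple isotypic module, and a Bassian one has finite length,
since a shift along an infinite sequence of simple summands embeds the module
in a proper quotient ([bassian_killed_fg]). So [Y = G + YP] with [G] finitely
generated, and [D = Y / G] satisfies [D = DP]. Such a [D] is injective for
primary modules ([primary_extension]), and if it were nonzero, a quotient of it
with simple socle [S] would embed in its own quotient by [S]
([divisible_super_bassian]). Hence [D = 0].

A primary component of a torsion module is a quotient of it, so this settles
the primary components of [M / H] ([super_bassian_primary_acc]). As to [H]
itself, generators are chosen one by one, each one spanning a torsion-free
module independent from the previous ones. If the choice never stops, the sum
[F] of the cyclic modules is infinite, and a quotient of [M] that is an
essential extension of [F / FP] is [P]-primary and super Bassian without being
noetherian, a contradiction ([infinite_free_sequence]). *)

(** * Submodules given by sets, linear relations and quotients *)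

Section SetSubmodules.
Variables (S : nzRingType) (M : lmodType S).
Implicit Types A B U : set M.

(** Submodules are plain sets here, so that unions of chains, intersections and
comparisons need no structure to be rebuilt. *)
Definition is_submod A : Prop :=
  A 0 /\ forall a x y, A x -> A y -> A (a *: x + y).

Lemma is_submod0 A : is_submod A -> A 0. Proof. by case. Qed.

Lemma is_submodD A x y : is_submod A -> A x -> A y -> A (x + y).
Proof. by case=> _ h Ax Ay; rewrite -[x]scale1r; apply: h. Qed.

Lemma is_submodZ A a x : is_submod A -> A x -> A (a *: x).
Proof. by case=> h0 h Ax; rewrite -[_ *: _]addr0; apply: h. Qed.

Lemma is_submodN A x : is_submod A -> A x -> A (- x).
Proof. by move=> h Ax; rewrite -scaleN1r; apply: is_submodZ. Qed.

Lemma is_submodB A x y : is_submod A -> A x -> A y -> A (x - y).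
Proof. by move=> h Ax Ay; apply: is_submodD => //; apply: is_submodN. Qed.

Lemma is_submod_sum A (I : Type) (r : seq I) (P : pred I) (F : I -> M) :
  is_submod A -> (forall i, P i -> A (F i)) -> A (\sum_(i <- r | P i) F i).
Proof.
move=> h hF; apply: (big_ind A) => //; first exact: is_submod0.
by move=> x y; apply: is_submodD.
Qed.

Lemma is_submodBr A x y : is_submod A -> A y -> A (x - y) -> A x.
Proof. by move=> h Ay Axy; rewrite -[x](subrK y); apply: is_submodD. Qed.

Lemma is_submodI A B : is_submod A -> is_submod B -> is_submod (A `&` B).
Proof.
move=> hA hB; split; first by split; apply: is_submod0.
by move=> a x y [Ax Bx] [Ay By]; split; [apply: hA.2 | apply: hB.2].
Qed.

Lemma is_submodT : is_submod [set: M]. Proof. by []. Qed.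

Lemma is_submod_zero : is_submod [set (0 : M)].
Proof. by split=> // a x y -> ->; rewrite scaler0 addr0. Qed.

Lemma is_submod_add A B : is_submod A -> is_submod B ->
  is_submod [set x | exists y z, [/\ A y, B z & x = y + z]].
Proof.
move=> hA hB; split.
  by exists 0, 0; rewrite addr0; split=> //; apply: is_submod0.
move=> a _ _ [y [z [Ay Bz ->]]] [y' [z' [Ay' Bz' ->]]].
exists (a *: y + y'), (a *: z + z'); split; [exact: hA.2 | exact: hB.2 |].
by rewrite scalerDr addrACA.
Qed.

Lemma is_submod_mem (N : submodClosed M) : is_submod [set x | x \in N].
Proof.
split=> [|a x y Nx Ny] /=; first exact: rpred0.
by apply: rpredD => //; apply: rpredZ.
Qed.

(** The proof is an argument so that a set known to be a submodule becomes a
[submodClosed] predicate, to which quotients apply. *)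
Definition set_submod A (_ : is_submod A) : {pred M} := fun x => `[< A x >].

Fact set_submodP A (hA : is_submod A) : submod_closed (set_submod hA).
Proof.
split; first by apply/asboolP; apply: is_submod0.
by move=> a x y /asboolP Ax /asboolP Ay; apply/asboolP; apply: hA.2.
Qed.

HB.instance Definition _ A (hA : is_submod A) :=
  GRing.isSubmodClosed.Build S M (set_submod hA) (set_submodP hA).

Lemma in_set_submod A (hA : is_submod A) x : (x \in set_submod hA) <-> A x.
Proof. by rewrite -[_ \in _]/(`[< A x >]); split=> [/asboolP|Ax] //; apply/asboolP. Qed.

End SetSubmodules.

Section LinearMaps.
Variables (S : nzRingType) (X Y : lmodType S).

Lemma mk_linear (h : X -> Y) :
  (forall a x y, h (a *: x + y) = a *: h x + h y) ->
  exists f : {linear X -> Y}, forall x, f x = h x.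
Proof.
move=> hl.
pose hL := GRing.isLinear.Build S X Y *:%R h hl.
pose f : {linear X -> Y} := HB.pack h hL.
by exists f.
Qed.

Lemma is_submod_preim (f : {linear X -> Y}) (B : set Y) :
  is_submod B -> is_submod [set x | B (f x)].
Proof.
move=> hB; split=> [|a x y Bx By] /=; first by rewrite linear0; apply: is_submod0.
by rewrite linearP; apply: hB.2.
Qed.

Lemma is_submod_im (f : {linear X -> Y}) (A : set X) :
  is_submod A -> is_submod (f @` A).
Proof.
move=> hA; split; first by exists 0; [apply: is_submod0 | rewrite linear0].
move=> a _ _ [x Ax <-] [y Ay <-]; exists (a *: x + y); last by rewrite linearP.
exact: hA.2.
Qed.

(** Homomorphisms between quotients are obtained from submodules of a product,
which avoids choosing representatives. *)
Lemma linear_of_relation (G : set (X * Y)) : is_submod G ->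
  (forall x, exists y, G (x, y)) -> (forall y, G (0, y) -> y = 0) ->
  exists f : {linear X -> Y}, forall x y, G (x, y) <-> f x = y.
Proof.
move=> hG /choice[h Gh] G0.
have uniqG x y y' : G (x, y) -> G (x, y') -> y = y'.
  move=> Gy Gy'; apply/eqP; rewrite -subr_eq0; apply/eqP/G0.
  by have /= := is_submodB hG Gy Gy'; rewrite -[_ - _]/(x - x, y - y') subrr.
have [|f fE] := @mk_linear h.
  move=> a x y; apply: (uniqG (a *: x + y)); first exact: Gh.
  by have := hG.2 a _ _ (Gh x) (Gh y).
exists f => x y; rewrite fE; split=> [Gxy|<-]; last exact: Gh.
exact: uniqG (Gh x) Gxy.
Qed.

End LinearMaps.

Section Projection.
Variables (S : nzRingType) (M : lmodType S) (N : submodClosed M).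

Lemma quotient_projection : exists p : {linear M -> quotient_module N},
  (forall y, exists x, p x = y) /\ (forall x, p x = 0 <-> x \in N).
Proof.
have [|p pE] := @mk_linear S M (quotient_module N) (fun x => \pi_(quotient_module N) x).
  by move=> a x y; rewrite Defs.pi_add Defs.pi_scale.
exists p; split=> [y|x]; first by exists (repr y); rewrite pE reprK.
have := Quotient.idealrBE (submod_zmod N) x 0; rewrite subr0 pE.
rewrite -[x \in _ in LHS]/(x \in N) => ->.
have -> : \pi_(quotient_module N) (0 : M) = 0.
  by rewrite -(scale0r (0 : M)) Defs.pi_scale; exact: (@scale0r S (quotient_module N)).
by split=> [/eqP|/eqP].
Qed.

Definition proj : {linear M -> quotient_module N} :=
  projT1 (cid quotient_projection).

Lemma proj_surj y : exists x, proj x = y.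
Proof. by rewrite /proj; case: cid => p []. Qed.

Lemma proj_eq0 x : proj x = 0 <-> x \in N.
Proof. by rewrite /proj; case: cid => p []. Qed.

End Projection.

(** * Chain conditions and finite generation *)

Section ChainConditions.
Variables (S : nzRingType) (M : lmodType S).
Implicit Types (A B U V : set M) (N : submodClosed M).

(** The maximal condition on the submodules inside [U], with an arbitrary
family [Phi]: in this form it transfers along homomorphisms without choosing
chains. *)
Definition acc_on U : Prop := forall Phi : set M -> Prop,
  (exists A, [/\ is_submod A, A `<=` U & Phi A]) ->
  exists A, [/\ is_submod A, A `<=` U, Phi A &
    forall B, is_submod B -> B `<=` U -> Phi B -> A `<=` B -> B `<=` A].

Lemma acc_on_sub U V : V `<=` U -> acc_on U -> acc_on V.
Proof.
move=> VU accU Phi [A [hA AV PA]].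
have [|B [hB BU [BV PB] maxB]] := accU (fun B => B `<=` V /\ Phi B).
  by exists A; split=> //; apply: subset_trans VU.
exists B; split=> // C hC CV PC; apply: maxB => //.
exact: subset_trans VU.
Qed.

Lemma acc_on_chain U (A : nat -> set M) : acc_on U ->
  (forall i, is_submod (A i)) -> (forall i, A i `<=` U) ->
  (forall i, A i `<=` A i.+1) ->
  exists n, forall m, (n <= m)%N -> A m `<=` A n.
Proof.
move=> accU hA AU AS.
have Ale i j : (i <= j)%N -> A i `<=` A j.
  by move/subnK<-; elim: (j - i)%N => [//|k IHk]; apply: subset_trans (AS _).
have [|B [_ _ [n ->] maxn]] := accU (fun B => exists n, B = A n).
  by exists (A 0%N); split=> //; exists 0%N.
exists n => m nm; apply: maxn => //; first by exists m.
exact: Ale.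
Qed.

(** Without a maximal member, dependent choice builds a strictly increasing
chain. *)
Lemma noetherian_acc : noetherian M -> acc_on [set: M].
Proof.
move=> noethM Phi [A0 [hA0 _ PA0]]; apply: contrapT => nomax.
have step A : is_submod A /\ Phi A ->
    exists B, [/\ is_submod B, Phi B, A `<=` B & ~ B `<=` A].
  move=> [hA PA]; apply: contrapT => noB; apply: nomax.
  exists A; split=> // B hB _ PB AB; apply: contrapT => nBA.
  by apply: noB; exists B.
pose T := {A : set M | is_submod A /\ Phi A}.
have /choice[g gP] (A : T) :
    exists B : T, sval A `<=` sval B /\ ~ sval B `<=` sval A.
  case: A => A hA /=; have [B [hB PB AB BA]] := step A hA.
  by exists (exist _ B (conj hB PB)).
pose C n := iter n g (exist _ A0 (conj hA0 PA0) : T).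
have hC n : is_submod (sval (C n)) := (svalP (C n)).1.
have [|n nP] := noethM (fun n => set_submod (hC n)).
  by move=> i x /in_set_submod Cx; apply/in_set_submod; apply: (gP _).1.
apply: (gP (C n)).2 => x Cx.
have := nP n.+1 (leqnSn n) x => Ex; apply/(in_set_submod (hC n)).
by rewrite -Ex; apply/in_set_submod.
Qed.

Lemma acc_noetherian N : acc_on [set x | x \in N] -> noetherian (submodule N).
Proof.
move=> accN C CS.
pose A i := val @` [set x : submodule N | x \in C i].
have [|||n nP] := @acc_on_chain _ A accN.
- by move=> i; apply: (@is_submod_im S (submodule N) M val); apply: is_submod_mem.
- by move=> i _ [x _ <-]; apply: (valP x).
- by move=> i _ [x Cx <-]; exists x => //; apply: CS.
exists n => m nm x; apply/idP/idP => Cx; last first.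
  move: nm Cx => /subnK<-; elim: (m - n)%N => [//|k IHk] Cx; exact/CS/IHk.
have [y Cy /val_inj<- //] : A n (val x) by apply: (nP m nm); exists x.
Qed.

End ChainConditions.

Section ChainConditionsMorphisms.
Variables (S : nzRingType) (M M' : lmodType S).
Implicit Types U : set M.

Lemma acc_on_image (f : {linear M -> M'}) U :
  is_submod U -> acc_on U -> acc_on (f @` U).
Proof.
move=> hU accU Phi [A [hA AU PA]].
have imK B : B `<=` f @` U -> f @` (U `&` [set x | B (f x)]) = B.
  move=> BU; apply/seteqP; split=> [_ [x [_ Bx] <-] //|y By].
  by have [x Ux xy] := BU y By; exists x => //; split=> //=; rewrite xy.
have [|B [hB BU PB maxB]] := accU (fun B => Phi (f @` B)).
  exists (U `&` [set x | A (f x)]); split; last by rewrite imK.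
    by apply: is_submodI => //; apply: is_submod_preim.
  by move=> x [].
exists (f @` B); split=> //; first exact: is_submod_im.
  by move=> _ [x Bx <-]; exists x => //; apply: BU.
move=> C hC CU PC BC; rewrite -(imK C CU); apply: image_subset.
apply: maxB.
- by apply: is_submodI => //; apply: is_submod_preim.
- by move=> x [].
- by rewrite imK.
- by move=> x Bx; split; [apply: BU | apply: BC; exists x].
Qed.

(** Two submodules [A <= B] with the same image and the same trace on the kernel
are equal; so one maximizes the image first, then the trace on the kernel. *)
Lemma acc_on_ext (f : {linear M -> M'}) U :
  is_submod U -> acc_on (U `&` [set x | f x = 0]) -> acc_on (f @` U) ->
  acc_on U.
Proof.
move=> hU acck acci Phi [A [hA AU PA]].
have hk B : is_submod B -> is_submod (B `&` [set x | f x = 0]).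
  move=> hB; apply: is_submodI => //.
  exact: (is_submod_preim f (@is_submod_zero S M')).
have [|B [hB _ [B0 [hB0 B0U PB0 EB]] maxB]] :=
    acci (fun B => exists B0, [/\ is_submod B0, B0 `<=` U, Phi B0 & f @` B0 = B]).
  exists (f @` A); split; [exact: is_submod_im | exact: image_subset |].
  by exists A.
have [|C [hC _ [C0 [hC0 C0U PC0 EC0 EC]] maxC]] :=
    acck (fun C => exists C0, [/\ is_submod C0, C0 `<=` U, Phi C0, f @` C0 = B
                               & C0 `&` [set x | f x = 0] = C]).
  exists (B0 `&` [set x | f x = 0]); split; [exact: hk | exact: setSI |].
  by exists B0.
exists C0; split=> // D hD DU PD C0D x Dx.
have EDB : f @` D = B.
  apply/seteqP; split; last by rewrite -EC0; apply: image_subset.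
  apply: maxB; [exact: is_submod_im | exact: image_subset | by exists D |].
  by rewrite -EC0; apply: image_subset.
have [y C0y xy] : (f @` C0) (f x) by rewrite EC0 -EDB; exists x.
apply: (is_submodBr hC0 C0y).
have : (D `&` [set x | f x = 0]) `<=` C.
  apply: maxC; [exact: hk | exact: setSI | by exists D |].
  by rewrite -EC; apply: setSI.
rewrite -EC => /(_ (x - y))[|//]; split; last by rewrite /= linearB xy subrr.
by apply: is_submodB => //; apply: C0D.
Qed.

End ChainConditionsMorphisms.

Section FiniteGeneration.
Variables (S : nzRingType) (M : lmodType S).
Implicit Types (A U : set M) (N : submodClosed M).

Definition lspan (y : nat -> M) (n : nat) : set M :=
  [set x | exists c : nat -> S, x = \sum_(i < n) c i *: y i].

Lemma is_submod_lspan y n : is_submod (lspan y n).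
Proof.
split=> [|a _ _ [c ->] [d ->]].
  by exists (fun=> 0); rewrite big1 // => i _; rewrite scale0r.
exists (fun i => a * c i + d i); rewrite scaler_sumr -big_split /=.
by apply: eq_bigr => i _; rewrite scalerDl scalerA.
Qed.

Lemma lspan_sub y n A : is_submod A -> (forall i, (i < n)%N -> A (y i)) ->
  lspan y n `<=` A.
Proof.
move=> hA Ay _ [c ->]; apply: is_submod_sum => // i _.
by apply: is_submodZ => //; apply: Ay.
Qed.

Lemma lspan_mem y n i : (i < n)%N -> lspan y n (y i).
Proof.
move=> i_n; exists (fun k => (k == i)%:R).
rewrite (bigD1 (Ordinal i_n)) //= eqxx scale1r big1 ?addr0 // => j /eqP ji.
by case: eqP => [ij|_]; rewrite ?scale0r //; case: ji; apply: val_inj.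
Qed.

Lemma lspan_ext (y y' : nat -> M) n : (forall i, (i < n)%N -> y i = y' i) ->
  lspan y n = lspan y' n.
Proof.
by move=> yy'; apply/seteqP; split=> _ [c ->]; exists c; apply: eq_bigr => i _;
  rewrite yy'.
Qed.

Lemma lspanS y n x : lspan y n.+1 x <->
  exists z a, lspan y n z /\ x = z + a *: y n.
Proof.
split=> [[c ->]|[_ [a [[c ->] ->]]]].
  by exists (\sum_(i < n) c i *: y i), (c n); split; [exists c | rewrite big_ord_recr].
exists (fun i => if i == n then a else c i); rewrite big_ord_recr /= eqxx.
by congr (_ + _); apply: eq_bigr => i _; rewrite ltn_eqF.
Qed.

Lemma lspan_le y m n : (m <= n)%N -> lspan y m `<=` lspan y n.
Proof.
move=> mn; apply: lspan_sub => [|i im]; first exact: is_submod_lspan.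
by apply: lspan_mem; apply: leq_trans mn.
Qed.

Definition fg_on U : Prop := exists y n, U = lspan y n.

(** A maximal finitely generated submodule absorbs every further generator. *)
Lemma acc_on_fg U : is_submod U -> acc_on U -> fg_on U.
Proof.
move=> hU accU.
have [|A [_ sU [y [n EA]] maxn]] := accU (fun A => exists y n, A = lspan y n).
  exists (lspan (fun=> 0) 0); split; [exact: is_submod_lspan | | by exists (fun=> 0), 0%N].
  by apply: lspan_sub.
subst A; exists y, n; apply/seteqP; split=> // x Ux.
pose y' k := if k == n then x else y k.
have y'E k : (k < n)%N -> y' k = y k by rewrite /y' => /ltn_eqF ->.
have sU' : lspan y' n.+1 `<=` U.
  apply: lspan_sub => // i; rewrite ltnS leq_eqVlt => /orP[/eqP->|i_n].
    by rewrite /y' eqxx.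
  by rewrite y'E //; apply: sU; apply: lspan_mem.
apply: (maxn (lspan y' n.+1)) => //; first exact: is_submod_lspan.
- by exists y', n.+1.
- apply: lspan_sub => [|i i_n]; first exact: is_submod_lspan.
  by rewrite -y'E //; apply: lspan_mem; apply: ltnW.
- by have := @lspan_mem y' n.+1 n (leqnn _); rewrite /y' eqxx.
Qed.

Lemma finitely_generated_fg N :
  finitely_generated (submodule N) -> fg_on [set x | x \in N].
Proof.
move=> [n [e eP]].
pose y k : M := if insub k is Some i then val (e i) else 0.
have yE (i : 'I_n) : y i = val (e i) by rewrite /y valK.
exists y, n; apply/seteqP; split=> [x Nx|].
  have [c cE] := eP (Sub x Nx); exists (fun k => if insub k is Some i then c i else 0).
  have -> : x = val (Sub x Nx : submodule N) by rewrite SubK.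
  rewrite cE raddf_sum; apply: eq_bigr => i _.
  by rewrite yE valK [LHS]linearZ.
apply: lspan_sub => [|i i_n]; first exact: is_submod_mem.
by rewrite -[i]/(val (Ordinal i_n)) yE; apply: (valP (e _)).
Qed.

Lemma fg_finitely_generated N :
  fg_on [set x | x \in N] -> finitely_generated (submodule N).
Proof.
move=> [y [n E]].
have yN (i : 'I_n) : y i \in N.
  by have := @lspan_mem y n i (ltn_ord i); rewrite -E.
exists n, (fun i : 'I_n => Sub (y i) (yN i)) => x.
have [c cE] : lspan y n (val x) by rewrite -E; apply: valP.
exists (fun i : 'I_n => c i); apply: val_inj; rewrite cE raddf_sum.
by apply: eq_bigr => i _; rewrite [RHS]linearZ.
Qed.

Lemma noetherian_finitely_generated : noetherian M -> finitely_generated M.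
Proof.
move=> /noetherian_acc/(acc_on_fg (@is_submodT _ M))[y [n E]].
exists n, (fun i : 'I_n => y i) => x.
have [c ->] : lspan y n x by rewrite -E.
by exists (fun i : 'I_n => c i).
Qed.

End FiniteGeneration.

Lemma acc_on_lspan (S : nzRingType) (M : lmodType S) (y : nat -> M) n :
  noetherian S^o -> acc_on (lspan y n).
Proof.
move=> /noetherian_acc accS; elim: n => [|n IHn].
  move=> Phi [A [hA AU PA]]; exists A; split=> // B hB BU _ _ x /BU[c ->].
  by rewrite big_ord0; apply: is_submod0.
pose X : lmodType S := quotient_module (set_submod (is_submod_lspan y n)).
pose p : {linear M -> X} := proj (set_submod (is_submod_lspan y n)).
have p0 x : p x = 0 <-> lspan y n x by rewrite proj_eq0; apply: in_set_submod.
apply: (@acc_on_ext _ _ _ p (lspan y n.+1)); first exact: is_submod_lspan.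
  by apply: acc_on_sub IHn => x [_ /p0].
have [|g gE] := @mk_linear S S^o X (fun a => (a : S) *: p (y n)).
  by move=> a b c; rewrite -[a *: (b : S^o)]/(a * b) scalerDl scalerA.
apply: acc_on_sub (acc_on_image (f := g) (@is_submodT _ _) accS).
move=> _ [x /lspanS[z [a [/p0 pz ->]]] <-].
by exists a => //; rewrite gE linearD pz add0r linearZ.
Qed.

Lemma acc_on_of_fg (S : nzRingType) (M : lmodType S) (U : set M) :
  noetherian S^o -> fg_on U -> acc_on U.
Proof. by move=> nS [y [n ->]]; apply: acc_on_lspan. Qed.

(** * Pseudo-complements *)

Section PseudoComplement.
Variables (S : nzRingType) (M : lmodType S).

(** With [C0 = 0] this gives a submodule maximal among those with zero
intersection with [A], so that [A] becomes essential in the quotient by [C].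
A nonzero [C0] inside [A] makes [A / C0] essential in a quotient of [M / C0];
and for [M] a product with [A] one factor, it extends partial homomorphisms. *)
Lemma pseudo_complement (C0 A : set M) : is_submod C0 -> is_submod A ->
  exists C, [/\ is_submod C, C0 `<=` C, C `&` A `<=` C0 &
    forall x, (forall a c, C c -> A (a *: x + c) -> C0 (a *: x + c)) -> C x].
Proof.
move=> hC0 hA.
pose T := {C : set M | [/\ is_submod C, C0 `<=` C & C `&` A `<=` C0]}.
pose le (C D : T) := `[< sval C `<=` sval D >].
have t0 : T by exists C0; split=> // x [].
have [||||C maxC] := @Zorn T le.
- by move=> C; apply/asboolP.
- by move=> C D E /asboolP CD /asboolP DE; apply/asboolP; apply: subset_trans DE.
- move=> [C hC] [D hD] /asboolP /= CD /asboolP /= DC.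
  by apply: eq_exist; apply/seteqP.
- move=> F totF.
  have [[C1 FC1]|nF] := pselect (exists C, F C); last first.
    by exists t0 => C FC; case: nF; exists C.
  pose U := [set x | exists2 C, F C & sval C x].
  have UP : [/\ is_submod U, C0 `<=` U & U `&` A `<=` C0].
    split; last 1 first.
    + by move=> x [[C FC Cx] Ax]; have [_ _] := svalP C; apply.
    + split; first by exists C1 => //; apply: is_submod0; have [] := svalP C1.
      move=> a x y [C FC Cx] [D FD Dy].
      have [/asboolP CD|/asboolP DC] := totF C D FC FD.
        by exists D => //; have [hD _ _] := svalP D; apply: hD.2 => //; apply: CD.
      by exists C => //; have [hC _ _] := svalP C; apply: hC.2 => //; apply: DC.
    + by move=> x C0x; exists C1 => //; have [_ h _] := svalP C1; apply: h.
  exists (exist _ U UP) => C FC; apply/asboolP => x Cx /=; by exists C.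
case: C maxC => C [hC C0C CA] maxC; exists C; split=> // x hx.
pose D := [set z | exists a c, C c /\ z = a *: x + c].
have CD : C `<=` D by move=> c Cc; exists 0, c; rewrite scale0r add0r.
have DP : [/\ is_submod D, C0 `<=` D & D `&` A `<=` C0].
  split; last 1 first.
  - by move=> _ [[a [c [Cc ->]]] Az]; apply: hx.
  - split=> [|b _ _ [a [c [Cc ->]]] [a' [c' [Cc' ->]]]].
      by apply: CD; apply: is_submod0.
    exists (b * a + a'), (b *: c + c'); split; first exact: hC.2.
    by rewrite scalerDl scalerDr scalerA addrACA.
  - exact: subset_trans CD.
have := maxC (exist _ D DP); rewrite /le /= => /(_ (asboolT CD)) [<-].
by exists 1, 0; rewrite scale1r addr0; split=> //; apply: is_submod0.
Qed.

End PseudoComplement.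

(** * Right ideals of hereditary noetherian rings *)

(** The right action of [r]: a right module over [R] is a left module over [R^c]. *)
Notation "x ** r" := (@GRing.scale _^c _ r x) (at level 40, left associativity).

Section RightModules.
Variables (R : nzRingType) (M : lmodType R^c).
Implicit Types (x y : M) (r s : R) (A : set M).

Lemma ractA x r s : x ** r ** s = x ** (r * s).
Proof. by rewrite scalerA. Qed.

Lemma ractDl x y r : (x + y) ** r = x ** r + y ** r.
Proof. exact: scalerDr. Qed.

Lemma ractDr x r s : x ** (r + s) = x ** r + x ** s.
Proof. exact: (scalerDl x (r : R^c) s). Qed.

Lemma ractBr x r s : x ** (r - s) = x ** r - x ** s.
Proof. exact: (scalerBl (r : R^c) s x). Qed.

Lemma ract1 x : x ** (1 : R) = x. Proof. exact: scale1r. Qed.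

Lemma ract0 x : x ** (0 : R) = 0. Proof. exact: scale0r. Qed.

Lemma ract_fix x r : x ** (1 - r) = 0 -> x = x ** r.
Proof. by rewrite ractBr ract1 => /eqP; rewrite subr_eq0 => /eqP. Qed.

End RightModules.

Lemma linear_ract (R : nzRingType) (M M' : lmodType R^c) (f : {linear M -> M'})
  (x : M) (r : R) : f (x ** r) = f x ** r.
Proof. exact: linearZ. Qed.

Section RightIdeals.
Variable R : nzRingType.
Implicit Types (A B E : set R) (a b r s x y : R).

(** A right ideal of [R] is a submodule of [R^c^o], so that the results on
submodules apply to it. *)
Definition right_ideal A : Prop := is_submod (A : set R^c^o).

Lemma right_idealP A : A 0 -> (forall x y, A x -> A y -> A (x + y)) ->
  (forall x r, A x -> A (x * r)) -> right_ideal A.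
Proof. by move=> A0 AD AM; split=> // a x y Ax Ay; apply: AD => //; apply: AM. Qed.

Lemma right_ideal0 A : right_ideal A -> A 0. Proof. by case. Qed.

Lemma right_idealD A x y : right_ideal A -> A x -> A y -> A (x + y).
Proof. exact: (@is_submodD _ R^c^o). Qed.

Lemma right_idealM A x r : right_ideal A -> A x -> A (x * r).
Proof. exact: (@is_submodZ _ R^c^o). Qed.

Lemma right_ideal_sum A (I : Type) (l : seq I) (P : pred I) (F : I -> R) :
  right_ideal A -> (forall i, P i -> A (F i)) -> A (\sum_(i <- l | P i) F i).
Proof. exact: (@is_submod_sum _ R^c^o). Qed.

Lemma right_ideal_principal a : right_ideal [set x | exists r, x = a * r].
Proof.
apply: right_idealP; first by exists 0; rewrite mulr0.
  by move=> _ _ [r ->] [s ->]; exists (r + s); rewrite mulrDr.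
by move=> _ r [s ->]; exists (s * r); rewrite mulrA.
Qed.

Lemma right_ideal_add_principal A a : right_ideal A ->
  right_ideal [set x | exists y r, A y /\ x = y + a * r].
Proof.
move=> hA; apply: right_idealP.
- by exists 0, 0; rewrite mulr0 addr0; split=> //; apply: right_ideal0.
- move=> _ _ [y [r [Ay ->]]] [y' [r' [Ay' ->]]]; exists (y + y'), (r + r').
  by rewrite mulrDr addrACA; split=> //; apply: right_idealD.
- move=> _ s [y [r [Ay ->]]]; exists (y * s), (r * s).
  by rewrite mulrDl mulrA; split=> //; apply: right_idealM.
Qed.

Lemma right_ideal_preim (M : lmodType R^c) (x : M) (A : set M) :
  is_submod A -> right_ideal [set r | A (x ** r)].
Proof.
move=> hA; apply: right_idealP => /=.
- by rewrite ract0; apply: is_submod0.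
- by move=> r s Ar As; rewrite ractDr; apply: is_submodD.
- by move=> r s Ar; rewrite -ractA; apply: is_submodZ.
Qed.

Definition two_sided A : Prop := right_ideal A /\ forall r x, A x -> A (r * x).

Lemma two_sided_ideal A : two_sided A -> exists I : ideal R, forall x, x \in I <-> A x.
Proof.
move=> [hA Al].
have hAl : submod_closed ((fun x => `[< A x >]) : {pred R^o}).
  split; first by apply/asboolP; apply: right_ideal0.
  move=> a x y /asboolP Ax /asboolP Ay; apply/asboolP.
  by apply: right_idealD => //; apply: Al.
have hAr : submod_closed ((fun x => `[< A x >]) : {pred R^c^o}).
  split; first by apply/asboolP; apply: right_ideal0.
  move=> a x y /asboolP Ax /asboolP Ay; apply/asboolP.
  by apply: right_idealD => //; apply: (@right_idealM A x a hA).
exists (Ideal hAl hAr) => x; rewrite -[_ \in _]/(`[< A x >]).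
by split=> [/asboolP|Ax] //; apply/asboolP.
Qed.

Lemma ideal_two_sided (I : ideal R) : two_sided [set x | x \in I].
Proof.
split; last by move=> r x; apply: ideal_mull.
apply: right_idealP => [|x y Ix Iy|x r Ix] /=.
- by have [] := ideal_left I.
- by have [_ /(_ 1 x y Ix Iy)] := ideal_left I; rewrite scale1r.
- exact: ideal_mulr.
Qed.

Lemma right_ideal_acc : noetherian R^c^o -> forall Phi : set R -> Prop,
  (exists A, right_ideal A /\ Phi A) ->
  exists A, [/\ right_ideal A, Phi A &
    forall B, right_ideal B -> Phi B -> A `<=` B -> B `<=` A].
Proof.
move=> /noetherian_acc nR Phi [A [hA PA]].
have [|B [hB _ PB maxB]] := nR Phi; first by exists A.
by exists B; split=> // C hC PC; apply: maxB.
Qed.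

Lemma right_ideal_fg A : noetherian R^c^o -> right_ideal A ->
  exists (g : nat -> R) n, (forall i, (i < n)%N -> A (g i)) /\
    forall x, A x -> exists c : nat -> R, x = \sum_(i < n) g i * c i.
Proof.
move=> /noetherian_acc nR hA.
have [|g [n ->]] := @acc_on_fg _ R^c^o A hA; first exact: acc_on_sub nR.
by exists g, n; split=> // i; apply: lspan_mem.
Qed.

(** Right linearity is required on [E] alone: a homomorphism from [E] is a
function on the whole ring with arbitrary values elsewhere. *)
Definition rlin_on E (f : R -> R) : Prop :=
  forall x y r, E x -> E y -> f (x * r + y) = f x * r + f y.

Lemma rlin_on0 E f : right_ideal E -> rlin_on E f -> f 0 = 0.
Proof.
move=> hE /(_ 0 0 (-1)); rewrite mul0r addr0 mulrN1 addNr; apply; exact: right_ideal0.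
Qed.

Lemma rlin_onM E f x r : right_ideal E -> rlin_on E f -> E x -> f (x * r) = f x * r.
Proof.
move=> hE hf Ex; rewrite -[x * r]addr0 hf //; last exact: right_ideal0.
by rewrite (rlin_on0 hE hf) addr0.
Qed.

Lemma rlin_on_sum E f (n : nat) (g c : nat -> R) : right_ideal E -> rlin_on E f ->
  (forall i, (i < n)%N -> E (g i)) ->
  f (\sum_(i < n) g i * c i) = \sum_(i < n) f (g i) * c i.
Proof.
move=> hE hf; elim: n => [|n IHn] Eg; first by rewrite !big_ord0 (rlin_on0 hE hf).
have Eg' i : (i < n)%N -> E (g i) by move=> i_n; apply/Eg/ltnW.
rewrite !big_ord_recr /= addrC hf ?IHn 1?addrC //; first exact: Eg.
by apply: right_ideal_sum => // i _; apply: right_idealM => //; apply: Eg'.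
Qed.

(** A finitely generated projective module has a dual basis: the coordinates of
a section of the surjection from a free module onto [E]. *)
Lemma dual_basis E : left_hereditary R^c -> noetherian R^c^o -> right_ideal E ->
  exists (n : nat) (g : nat -> R) (phi : nat -> R -> R),
  [/\ forall i, (i < n)%N -> E (g i), forall i, rlin_on E (phi i) &
      forall x, E x -> x = \sum_(i < n) g i * phi i x].
Proof.
move=> hered nR hE; have [g [n [Eg gE]]] := right_ideal_fg nR hE.
pose I := set_submod hE; pose F : lmodType R^c := {ffun 'I_n -> R^c^o}.
pose s (c : F) : R^c^o := \sum_(i < n) g i * (c i : R).
have sI c : s c \in I.
  apply/in_set_submod; apply: right_ideal_sum => // i _.
  by apply: right_idealM => //; apply: Eg.
have [|p pE] := @mk_linear _ F (submodule I) (fun c => Sub (s c) (sI c)).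
  move=> a c d; apply: val_inj; rewrite linearP /= /s scaler_sumr -big_split.
  by apply: eq_bigr => i _; rewrite !ffunE mulrDr mulrA.
have [|h hP] := hered I F (submodule I) p idfun.
  move=> x; have /in_set_submod/gE[c xE] := valP x.
  exists [ffun i : 'I_n => c i]; apply: val_inj; rewrite pE /= xE /s.
  by apply: eq_bigr => i _; rewrite ffunE.
pose e x : submodule I := insubd 0 (x : R^c^o).
have eE x : E x -> val (e x) = x by move=> Ex; rewrite insubdK //; apply/in_set_submod.
exists n, g, (fun k x => if insub k is Some i then h (e x) i else 0); split=> //.
  move=> k x y r Ex Ey; case: insub => [i|]; last by rewrite mul0r addr0.
  have -> : e (x * r + y) = (r : R^c) *: e x + e y.
    apply: val_inj; rewrite linearP /= !eE //.
    by apply: right_idealD => //; apply: right_idealM.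
  by rewrite linearP !ffunE.
move=> x Ex; rewrite -{1}(eE x Ex) -{1}[e x]/(idfun (e x)) -hP pE /= /s.
by apply: eq_bigr => i _; rewrite valK.
Qed.

(** Essentiality tested on principal right ideals. *)
Definition essential E : Prop := forall a, a != 0 -> exists s, E (a * s) /\ a * s != 0.

Lemma essential_idealP E : @essential_ideal R^c E <-> essential E.
Proof.
split=> [essE a a0|essE I nzI].
  have inI r := @in_set_submod _ R^c^o _ (right_ideal_principal a) r.
  have [nz|r [rI as0 Eas]] := essE (set_submod (right_ideal_principal a)).
    by case/eqP: a0; apply: nz; apply/inI; exists 1; rewrite mulr1.
  by have [s rE] := (inI r).1 rI; exists s; rewrite -rE.
have [a [Ia a0]] : exists a, a \in I /\ a != 0.
  apply: contrapT => h; apply: nzI => x Ix; apply: contrapT => /eqP x0.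
  by apply: h; exists x.
have [s [Eas as0]] := essE a a0; exists (a * s); split=> //.
exact: (@rpredZ _ _ I (s : R^c) a Ia).
Qed.

(** The annihilator modulo [B] is essential when [B / A] is essential in the
module [M / A]. *)
Lemma essential_colon (M : lmodType R^c) (A B : set M) : is_submod A -> A `<=` B ->
  (forall x : M, ~ A x -> exists r : R, B (x ** r) /\ ~ A (x ** r)) ->
  forall x : M, essential [set r | B (x ** r)].
Proof.
move=> hA AB h x a a0.
have [Axa|nA] := pselect (A (x ** a)).
  by exists 1; rewrite mulr1; split=> //; apply: AB.
have [r [Br nAr]] := h _ nA; exists r; rewrite /= -ractA; split=> //.
by apply/eqP => ar0; apply: nAr; rewrite ractA ar0 ract0; apply: is_submod0.
Qed.

Lemma essential_transporter E x : essential E -> right_ideal E ->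
  essential [set r | E (x * r)].
Proof.
move=> essE hE a a0; have [xa0|xa0] := eqVneq (x * a) 0.
  by exists 1; rewrite /= mulr1 xa0; split=> //; apply: right_ideal0.
have [s [Es s0]] := essE _ xa0; exists s; rewrite /= mulrA; split=> //.
by apply: contraNneq s0; rewrite -mulrA => ->; rewrite mulr0.
Qed.

(** Hereditary rings are nonsingular: by a dual basis of [xR] there is an [e]
with [xe = x] such that [xr = 0] forces [er = 0]; an essential right ideal
meets [eR], hence cannot annihilate [x] unless [x = 0]. *)
Lemma right_nonsingular E x : left_hereditary R^c -> noetherian R^c^o ->
  essential E -> (forall r, E r -> x * r = 0) -> x = 0.
Proof.
move=> hered nR essE xE.
have [n [g [phi [Eg hphi xphi]]]] := dual_basis hered nR (right_ideal_principal x).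
have xx : [set y | exists r, y = x * r] x by exists 1; rewrite mulr1.
have /choice[c cE] (i : nat) : exists c, (i < n)%N -> g i = x * c.
  have [i_n|] := ltnP i n; last by exists 0.
  by have [c cE] := Eg i i_n; exists c.
pose e := \sum_(i < n) c i * phi i x.
have xe : x * e = x.
  rewrite {2}(xphi x xx) mulr_sumr; apply: eq_bigr => i _.
  by rewrite mulrA -cE.
apply/eqP; apply: contrapT => /negP x0.
have e0 : e != 0 by apply: contraNneq x0 => e0; rewrite -xe e0 mulr0.
have [s [Es /eqP[]]] := essE e e0.
have xs : x * s = 0 by rewrite -xe -mulrA xE.
rewrite /e mulr_suml big1 // => i _; rewrite -mulrA -(rlin_onM _ _ (hphi i)) //.
  by rewrite xs (rlin_on0 _ (hphi i)) ?mulr0 //; apply: right_ideal_principal.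
exact: right_ideal_principal.
Qed.

Lemma left_free_acc n : noetherian R^o -> acc_on [set: {ffun 'I_n -> R^o}].
Proof.
move=> nR; apply: acc_on_of_fg => //.
exists (fun k => [ffun j : 'I_n => (val j == k)%:R]), n.
apply/seteqP; split=> // x _.
exists (fun k => if insub k is Some i then x i else 0).
apply/ffunP => j; rewrite sum_ffunE (bigD1 j) //= big1 ?addr0.
  by rewrite valK !ffunE eqxx [RHS]mulr1.
move=> i ij; rewrite valK !ffunE; case: eqP => [/val_inj ji|_].
  by rewrite ji eqxx in ij.
exact: mulr0.
Qed.

(** Restriction to [E] embeds the dual of a right ideal [I] above [E] in the dual
of [E], which is a submodule of a free left module of finite rank. A smaller
[I] has a larger dual, so the maximal condition on the left gives a minimal [I]:
two comparable right ideals with the same dual coincide, because the dual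
basis of the smaller one also expresses the elements of the larger one. *)
Lemma right_ideal_dcc E : left_hereditary R^c -> noetherian R^c^o -> noetherian R^o ->
  right_ideal E -> essential E -> forall Phi : set R -> Prop,
  (exists I, [/\ right_ideal I, E `<=` I & Phi I]) ->
  exists I, [/\ right_ideal I, E `<=` I, Phi I &
    forall I', right_ideal I' -> E `<=` I' -> Phi I' -> I' `<=` I -> I `<=` I'].
Proof.
move=> hered nR nL hE essE Phi [I0 [hI0 EI0 PI0]].
have [e [n [Ee eE]]] := right_ideal_fg nR hE.
pose V : lmodType R := {ffun 'I_n -> R^o}.
pose dual (I : set R) : set V :=
  [set v | exists f, rlin_on I f /\ forall i : 'I_n, v i = f (e i)].
have hdual I : right_ideal I -> is_submod (dual I).
  move=> hI; split=> [|a v w [f [hf vf]] [f' [hf' wf]]].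
    exists (fun=> 0); split=> [x y r _ _|i]; first by rewrite mul0r addr0.
    by rewrite ffunE.
  exists (fun x => a * f x + f' x); split=> [x y r Ix Iy|i].
    by rewrite hf // hf' // mulrDr mulrDl mulrA addrACA.
  by rewrite !ffunE vf wf.
have [|W [_ _ [I [hI EI PI EW]] maxI]] := @left_free_acc n nL
    (fun W => exists I, [/\ right_ideal I, E `<=` I, Phi I & W = dual I]).
  by exists (dual I0); split=> //; [apply: hdual | exists I0].
subst W; exists I; split=> // I' hI' EI' PI' I'I x Ix.
have dualI : dual I' `<=` dual I.
  apply: maxI => //; [exact: hdual | by exists I' |].
  by move=> v [f [hf vf]]; exists f; split=> // y z r I'y I'z; apply: hf; apply: I'I.
have [k [g [phi [Ig hphi phiE]]]] := dual_basis hered nR hI'.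
have /choice[psi psiP] (i : nat) : exists f, rlin_on I f /\ forall j : 'I_n, phi i (e j) = f (e j).
  have [|f [hf vf]] := dualI [ffun j : 'I_n => phi i (e j)].
    by exists (phi i); split=> // j; rewrite ffunE.
  by exists f; split=> // j; rewrite -vf ffunE.
have psi_phi i y : E y -> psi i y = phi i y.
  have [hpsi epsi] := psiP i; move/eE => [c ->].
  rewrite (rlin_on_sum _ hI hpsi); last by move=> j j_n; apply/EI/Ee.
  rewrite (rlin_on_sum _ hI' (hphi i)); last by move=> j j_n; apply/EI'/Ee.
  by apply: eq_bigr => j _; rewrite epsi.
(* The difference vanishes on the essential right ideal of the [r] with [xr] in
   [E], where [psi] and [phi] agree. *)
suff /eqP : x - \sum_(i < k) g i * psi i x = 0.
  rewrite subr_eq0 => /eqP->; apply: right_ideal_sum => // i _.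
  by apply: right_idealM => //; apply: Ig.
apply: (right_nonsingular hered nR (essential_transporter x essE hE)) => r /= Exr.
rewrite mulrBl mulr_suml (_ : \sum_(i < k) _ = x * r) ?subrr //.
rewrite [RHS](phiE (x * r)); last exact: EI'.
apply: eq_bigr => i _; rewrite -mulrA; congr (_ * _).
by rewrite -(rlin_onM r hI (psiP i).1 Ix) psi_phi.
Qed.

End RightIdeals.

(** * Prime rings and bounded essential right ideals *)

Section PrimeRings.
Variable R : nzRingType.
Implicit Types (A E I : set R) (a b r s x : R).

(** Apply primeness to the right annihilator of [aR] and to the left annihilator
of that ideal. *)
Lemma prime_ring_elt a b : prime_ring R -> a != 0 -> b != 0 ->
  exists s, a * s * b != 0.
Proof.
move=> prR a0 b0; apply: contrapT => h.
have asb s : a * s * b = 0 by apply/eqP; apply: contrapT => /negP n; apply: h; exists s.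
pose J := [set y | forall s, a * s * y = 0].
have [|J' J'E] := @two_sided_ideal R J.
  split=> [|r x Jx s]; last by rewrite mulrA -(mulrA a s r) Jx.
  apply: right_idealP => [s|x y Jx Jy s|x r Jx s]; first by rewrite mulr0.
    by rewrite mulrDr Jx Jy addr0.
  by rewrite mulrA Jx mul0r.
have [|I IE] := @two_sided_ideal R [set x | forall y, J y -> x * y = 0].
  split=> [|r x Ix y Jy]; last by rewrite -mulrA Ix ?mulr0.
  apply: right_idealP => [y _|x y Ix Iy z Jz|x r Ix y Jy]; first by rewrite mul0r.
    by rewrite mulrDl Ix ?Iy ?addr0.
  by rewrite -mulrA Ix // => s; rewrite !mulrA -(mulrA a s r) Jy.
case: (prR I J') => [x [s [sP ->]]|I0|J0] /=.
- rewrite big_seq big1 // => p /sP[/IE Ip /J'E Jp]; exact: Ip.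
- case/eqP: a0; apply: I0; apply/IE => y Jy; have := Jy 1; by rewrite mulr1.
- by case/eqP: b0; apply: J0; apply/J'E.
Qed.

Definition nonzero_ideal I : Prop := two_sided I /\ exists r, I r /\ r != 0.

Lemma nonzero_ideal_essential I : prime_ring R -> nonzero_ideal I -> essential I.
Proof.
move=> prR [[hI Il] [r [Ir r0]]] a a0; have [s asr] := prime_ring_elt prR a0 r0.
by exists (s * r); rewrite mulrA; split=> //; apply: Il.
Qed.

(** [R / Z] is a simple module, hence not faithful. The conclusion says that the
two-sided ideal generated by [j] annihilates it. *)
Lemma simple_quotient_not_faithful Z : non_primitive R -> right_ideal Z -> ~ Z 1 ->
  (forall r, ~ Z r -> exists s, Z (1 - r * s)) ->
  exists j, j != 0 /\ forall t, Z (t * j).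
Proof.
move=> [np _] hZ Z1 maxZ.
pose V : lmodType R^c := quotient_module (set_submod hZ).
pose p : {linear R^c^o -> V} := proj (set_submod hZ).
have p0 r : p r = 0 <-> Z r by rewrite proj_eq0; apply: in_set_submod.
have pM (r s : R) : p (r * s) = p r ** s.
  by rewrite -[r * s]/((s : R^c) *: (r : R^c^o)) linearZ.
have simpleV : simple_module V.
  split; first by exists (p (1 : R)); apply/eqP => /p0.
  move=> N; have [|nzN] := pselect (zero_submodule N); [by left | right=> x].
  have [r [Nr nZr]] : exists r : R, p r \in N /\ ~ Z r.
    apply: contrapT => h; apply: nzN => y; have [r <-] := proj_surj y => Nr.
    by apply/p0; apply: contrapT => nZr; apply: h; exists r.
  have [s Zs] := maxZ r nZr; have [t <-] := proj_surj x.
  have -> : proj (set_submod hZ) t = p r ** (s * (t : R)).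
    rewrite -pM; apply/eqP; rewrite -subr_eq0 -linearB; apply/eqP/p0.
    by have := right_idealM (t : R) hZ Zs; rewrite mulrBl mul1r -mulrA.
  exact: (@rpredZ _ _ N).
apply: contrapT => h; apply: np; exists V; split=> // r rV.
apply/eqP; apply: contrapT => /negP r0; apply: h; exists r; split=> // t.
by apply/p0; rewrite pM; apply: rV.
Qed.

(** The annihilator of the simple module [R / Z], for [Z] a maximal right ideal. *)
Lemma exists_nonzero_proper_ideal : non_primitive R -> noetherian R^c^o ->
  exists I, nonzero_ideal I /\ ~ I 1.
Proof.
move=> np nR; have [|Z [hZ Z1 maxZ]] := right_ideal_acc nR (Phi := fun A => ~ A 1).
  exists [set 0]; split; first exact: (@is_submod_zero _ R^c^o).
  by apply/eqP; rewrite oner_eq0.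
have [r nZr|j [j0 jZ]] := simple_quotient_not_faithful np hZ Z1.
  apply: contrapT => h; apply: (nZr); apply: maxZ (right_ideal_add_principal r hZ) _ _ _ _.
  - by move=> [z [s [Zz E1]]]; apply: h; exists s; rewrite E1 addrK.
  - by move=> z Zz; exists z, 0; rewrite mulr0 addr0.
  - by exists 0, 1; rewrite mulr1 add0r; split=> //; apply: right_ideal0.
exists [set r | forall t, Z (t * r)]; split; last by move=> /(_ 1); rewrite mulr1.
split; last by exists j.
split=> [|r x Zx t]; last by rewrite mulrA.
apply: right_idealP => [t|x y Zx Zy t|x r Zx t].
- by rewrite mulr0; apply: right_ideal0.
- by rewrite mulrDr; apply: right_idealD.
- by rewrite mulrA; apply: right_idealM.
Qed.

(** Among the essential right ideals that contain no nonzero ideal take a maximal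
one, [F], and a minimal [U] strictly above [F]. Then [U] contains a nonzero
ideal, and [U / F] is simple, hence annihilated by a nonzero ideal; the product
of the two ideals lies in [F]. *)
Lemma essential_bounded E : hnp_ring R -> non_primitive R ->
  right_ideal E -> essential E -> exists r, r != 0 /\ forall t, E (t * r).
Proof.
move=> [[hered _] [nR nL] prR] np hE0 essE0; apply: contrapT => nb0.
pose bdd A := exists r, r != 0 /\ forall t, A (t * r).
have [|{hE0 essE0 nb0}F [hF [essF nbF] maxF]] := right_ideal_acc nR
    (Phi := fun A => essential A /\ ~ bdd A); first by exists E.
have F1 : ~ F 1.
  move=> F1; apply: nbF; exists 1; rewrite oner_neq0; split=> // t.
  by rewrite mulr1 -[t]mul1r; apply: right_idealM.
have [|U [hU FU [u [Uu nFu]] minU]] := right_ideal_dcc hered nR nL hF essF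
    (Phi := fun A => exists x, A x /\ ~ F x).
  by exists [set: R]; split=> //; exists 1.
have bddU : bdd U.
  apply: contrapT => nbU; apply: nFu; apply: (maxF U) => //; split=> // a a0.
  by have [s [Fs s0]] := essF a a0; exists s; split=> //; apply: FU.
have Usub v t : U v -> ~ F v -> U t -> exists y r, F y /\ t = y + v * r.
  move=> Uv nFv; move: t; apply: (minU [set x | exists y r, F y /\ x = y + v * r]).
  - exact: right_ideal_add_principal.
  - by move=> y Fy; exists y, 0; rewrite mulr0 addr0.
  - by exists v; split=> //; exists 0, 1; rewrite mulr1 add0r; split=> //; apply: right_ideal0.
  - by move=> _ [y [r [Fy ->]]]; apply: right_idealD => //; [apply: FU | apply: right_idealM].
have [||r nZr|j [j0 jP]] := @simple_quotient_not_faithful [set r | F (u * r)] np.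
- exact: (right_ideal_preim (M := R^c^o) u hF).
- by rewrite /= mulr1.
- have [|y [s [Fy uE]]] := Usub (u * r) u _ nZr Uu; first exact: right_idealM.
  by exists s; rewrite /= mulrBr mulr1 mulrA {1}uE addrK.
have [i [i0 iU]] := bddU; have [s isj] := prime_ring_elt prR i0 j0.
apply: nbF; exists (i * s * j); split=> // t; rewrite !mulrA.
have [|y [r [Fy ->]]] := Usub u (t * i * s) Uu nFu; first exact: right_idealM.
rewrite mulrDl; apply: right_idealD => //; first exact: right_idealM.
by rewrite -mulrA; apply: jP.
Qed.

End PrimeRings.

Section DedekindPrime.
Variables (R : nzRingType) (Q : unitRingType) (iota : {rmorphism R -> Q}).
Hypothesis ded : dedekind_prime_ring iota.
Implicit Types (A B E I : set R) (a b r s x : R) (P : ideal R).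

Let hnpR : hnp_ring R. Proof. by case: ded. Qed.
Let hered : left_hereditary R^c. Proof. by case: hnpR => -[]. Qed.
Let nR : noetherian R^c^o. Proof. by case: hnpR => _ []. Qed.
Let nL : noetherian R^o. Proof. by case: hnpR => _ []. Qed.
Let prR : prime_ring R. Proof. by case: hnpR. Qed.
Let iota_inj : injective iota. Proof. by case: ded => _ []. Qed.

(** [J] is the inverse of [I]. The equations [IJ = R] and [JI = R] are stated as
induction principles for [1], which spares the manipulation of sums. *)
Lemma ideal_inverse I : nonzero_ideal I -> exists J : set Q,
  [/\ forall b (c : Q), I b -> J c -> exists r, iota r = iota b * c,
      forall b (c : Q), I b -> J c -> exists r, iota r = c * iota b,
      forall K : set Q, K 0 -> (forall x y : Q, K x -> K y -> K (x + y)) ->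
        (forall b (c : Q), I b -> J c -> K (iota b * c)) -> K 1
    & forall K : set Q, K 0 -> (forall x y : Q, K x -> K y -> K (x + y)) ->
        (forall b (c : Q), I b -> J c -> K (c * iota b)) -> K 1].
Proof.
move=> [tI [r [Ir r0]]]; have [I' I'E] := two_sided_ideal tI.
have [J [_ IJ JI]] : invertible_ideal iota I'.
  case: ded => _ _; apply => I'0; case/eqP: r0; apply: I'0; exact/I'E.
have sum_ind (K : set Q) (A B : set Q) (x : Q) : K 0 -> (forall x y : Q, K x -> K y -> K (x + y)) ->
    (forall a b : Q, A a -> B b -> K (a * b)) -> mul_set A B x -> K x.
  move=> K0 KD KM [s [sP ->]]; rewrite big_seq; apply: big_ind => // p /sP[Ap Bp].
  exact: KM.
have one1 : range iota 1 by exists 1; rewrite ?rmorph1.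
exists J; split=> [b c Ib Jc|b c Ib Jc|K K0 KD KM|K K0 KD KM].
- have [y _ <-] : range iota (iota b * c); last by exists y.
  rewrite -IJ; exists [:: (iota b, c)]; rewrite big_seq1; split=> // p.
  by rewrite inE => /eqP-> /=; split=> //; exists b => //; apply/I'E.
- have [y _ <-] : range iota (c * iota b); last by exists y.
  rewrite -JI; exists [:: (c, iota b)]; rewrite big_seq1; split=> // p.
  by rewrite inE => /eqP-> /=; split=> //; exists b => //; apply/I'E.
- move: one1; rewrite -IJ; apply: sum_ind => // _ c [b Ib <-] Jc.
  by apply: KM => //; apply/I'E.
- move: one1; rewrite -JI; apply: sum_ind => // c _ Jc [b Ib <-].
  by apply: KM => //; apply/I'E.
Qed.

(** The product of two sets, as the intersection of the additive sets that
contain all products: elimination needs no explicit sum. *)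
Definition product A B : set R := [set x | forall K : set R, K 0 ->
  (forall x y, K x -> K y -> K (x + y)) ->
  (forall a b, A a -> B b -> K (a * b)) -> K x].

Lemma product_mem A B a b : A a -> B b -> product A B (a * b).
Proof. by move=> Aa Bb K _ _; apply. Qed.

Lemma product0 A B : product A B 0. Proof. by move=> K K0 _ _. Qed.

Lemma productD A B x y : product A B x -> product A B y -> product A B (x + y).
Proof. move=> hx hy K K0 KD KM; exact: KD (hx K K0 KD KM) (hy K K0 KD KM). Qed.

Lemma mul_set_product A B x : mul_set A B x -> product A B x.
Proof.
move=> [s [sP ->]] K K0 KD KM; rewrite big_seq; apply: big_ind => // p /sP[].
exact: KM.
Qed.

(** From [I <= IA], multiplication by the inverse of [I] gives [R <= A]. *)
Lemma cancel_left I A : nonzero_ideal I -> two_sided A ->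
  (forall x, I x -> product I A x) -> A 1.
Proof.
move=> nzI [hA Al] IA; have [J [_ JI _ J1]] := ideal_inverse nzI.
have [||b c Ib Jc|x [Ax /eqP]] := J1 [set q | exists x, A x /\ q = iota x].
- by exists 0; rewrite rmorph0; split=> //; apply: right_ideal0.
- move=> _ _ [x [Ax ->]] [y [Ay ->]]; exists (x + y); rewrite rmorphD.
  by split=> //; apply: right_idealD.
- apply: (IA b Ib [set b | exists x, A x /\ c * iota b = iota x]) => /=.
  + by exists 0; rewrite !rmorph0 mulr0; split=> //; apply: right_ideal0.
  + move=> x y [z [Az zE]] [w [Aw wE]]; exists (z + w).
    by rewrite !rmorphD mulrDr zE wE; split=> //; apply: right_idealD.
  + move=> y a Iy Aa; have [r rE] := JI y c Iy Jc; exists (r * a).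
    by rewrite !rmorphM mulrA rE; split=> //; apply: Al.
- by rewrite -(rmorph1 iota) => /eqP/iota_inj->.
Qed.

(** From [I <= AI], multiplication by the inverse of [I] gives [R <= A]. *)
Lemma cancel_right I A : nonzero_ideal I -> two_sided A ->
  (forall x, I x -> product A I x) -> A 1.
Proof.
move=> nzI [hA Al] IA; have [J [IJ _ J1 _]] := ideal_inverse nzI.
have [||b c Ib Jc|x [Ax /eqP]] := J1 [set q | exists x, A x /\ q = iota x].
- by exists 0; rewrite rmorph0; split=> //; apply: right_ideal0.
- move=> _ _ [x [Ax ->]] [y [Ay ->]]; exists (x + y); rewrite rmorphD.
  by split=> //; apply: right_idealD.
- apply: (IA b Ib [set b | exists x, A x /\ iota b * c = iota x]) => /=.
  + by exists 0; rewrite !rmorph0 mul0r; split=> //; apply: right_ideal0.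
  + move=> x y [z [Az zE]] [w [Aw wE]]; exists (z + w).
    by rewrite !rmorphD mulrDl zE wE; split=> //; apply: right_idealD.
  + move=> a y Aa Iy; have [r rE] := IJ y c Iy Jc; exists (a * r).
    by rewrite !rmorphM -mulrA rE; split=> //; apply: right_idealM.
- by rewrite -(rmorph1 iota) => /eqP/iota_inj->.
Qed.

(** * Maximal ideals of a Dedekind prime ring *)

Section MaximalIdeal.
Variable P : ideal R.
Hypothesis maxP : maximal_invertible_ideal iota P.

Let PE : set R := [set x | x \in P].

Lemma max_ideal_nonzero : nonzero_ideal PE.
Proof.
split; first exact: ideal_two_sided.
apply: contrapT => h; case: maxP => -[[J [_ PJ _]] _] _.
have : range iota 1 by exists 1; rewrite ?rmorph1.
rewrite -PJ => -[s [sP /eqP]]; rewrite big_seq big1 ?oner_eq0 // => p /sP[[x Px <-] _].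
have -> : x = 0 by apply/eqP; apply: contrapT => /negP x0; apply: h; exists x.
by rewrite rmorph0 mul0r.
Qed.

Lemma max_ideal_proper : ~ PE 1.
Proof.
move=> P1; case: maxP => -[_ PT] _; case: PT; apply/seteqP; split=> // x _.
by rewrite -[x]mul1r; apply: ideal_mulr.
Qed.

(** In a Dedekind prime ring every nonzero ideal is invertible, so that a maximal
invertible ideal is a maximal ideal. *)
Lemma max_ideal_max A : two_sided A -> PE `<=` A ->
  (exists x, A x /\ ~ PE x) -> A 1.
Proof.
move=> tA PA [x [Ax nPx]]; apply: contrapT => nA1.
have [I IE] := two_sided_ideal tA.
case: maxP => _ maxI; apply: nPx; rewrite /PE /= -(maxI I) //; first exact/IE.
  split; last by move=> IT; apply/nA1/IE; have : ideal_set I 1 by rewrite IT.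
  case: ded => _ _; apply => I0; have [_ [r [Pr /eqP]]] := max_ideal_nonzero.
  by apply; apply: I0; apply/IE/PA.
by move=> y /PA/IE.
Qed.

Lemma max_ideal_comaximal A : two_sided A -> ~ A `<=` PE -> exists a, A a /\ PE (1 - a).
Proof.
move=> [hA Al] /existsNP[x /not_implyP[Ax nPx]]; have [[hP Pl] _] := max_ideal_nonzero.
have := @max_ideal_max [set x | exists a p, [/\ A a, PE p & x = a + p]].
case.
- split; first exact: (@is_submod_add _ R^c^o).
  move=> r _ [a [p [Aa Pp ->]]]; exists (r * a), (r * p).
  by rewrite mulrDr; split=> //; [apply: Al | apply: Pl].
- by move=> p Pp; exists 0, p; rewrite add0r; split=> //; apply: right_ideal0.
- exists x; split=> //; exists x, 0; rewrite addr0; split=> //; exact: right_ideal0.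
- by move=> a [p [Aa Pp ->]]; exists a; split=> //; rewrite addrC addKr.
Qed.

(** Powers are defined by multiplication on the right; this is the same on the
left. *)
Lemma ideal_pow_product k x : ideal_pow P k.+1 x -> product PE (ideal_pow P k) x.
Proof.
elim: k x => [|k IHk] x; move/mul_set_product => hx K K0 KD KM; apply: hx => // a b.
  move=> _ Pb; rewrite -[a * b]mulr1; apply: KM => //; exact: ideal_mull.
move=> /IHk ha Pb; apply: (ha [set y | K (y * b)]) => /=.
- by rewrite mul0r.
- by move=> y z Ky Kz; rewrite mulrDl; apply: KD.
- move=> y z Py Pz; rewrite -mulrA; apply: KM => //.
  exists [:: (z, b)]; rewrite big_seq1; split=> // p.
  by rewrite inE => /eqP->.
Qed.

Lemma ideal_powM k x p : ideal_pow P k x -> PE p -> ideal_pow P k.+1 (x * p).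
Proof.
move=> Px Pp; exists [:: (x, p)]; rewrite big_seq1; split=> // q.
by rewrite inE => /eqP->.
Qed.

(** Take [1 - a' = (1 - a) ^ n]; then [a'] is a multiple of [a] on both sides. *)
Lemma coprime_pow n a : PE (1 - a) -> exists a', [/\ ideal_pow P n (1 - a'),
  exists c, a' = c * a & exists d, a' = a * d].
Proof.
move=> Pa; elim: n => [|n [a' [Pa' [c ac] [d ad]]]].
  by exists 0; split=> //; exists 0; rewrite ?mul0r ?mulr0.
exists (a' + a - a' * a); split.
- have -> : 1 - (a' + a - a' * a) = (1 - a') * (1 - a).
    by rewrite mulrBr mulr1 mulrBl mul1r !opprB !addrA opprD !addrA [1 - a' + _]addrAC.
  exact: ideal_powM.
- by exists (c + 1 - a'); rewrite mulrBl mulrDl mul1r -ac.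
- by exists (d + 1 - d * a); rewrite mulrBr mulrDr mulr1 mulrA -ad.
Qed.

(** The ideals [{r | r P^k <= I}] increase with [k]; let [A] be the last one. If
[A <= P], then the ideal [A P^-1] multiplies [P^(k + 1)] into [I], so that it
lies in [A]; hence [A <= AP], which cancellation forbids. So [A] is comaximal
with [P]. *)
Lemma coprime_right I : nonzero_ideal I -> exists k a, PE (1 - a) /\
  forall p, ideal_pow P k p -> I (a * p).
Proof.
move=> [[hI Il] nzI].
pose A k := [set r | forall p, ideal_pow P k p -> I (r * p)].
have tA k : two_sided (A k).
  split=> [|r x Ax p Pp]; last by rewrite -mulrA; apply: Il; apply: Ax.
  apply: right_idealP => [p _|x y Ax Ay p Pp|x r Ax p Pp].
  - by rewrite mul0r; apply: right_ideal0.
  - by rewrite mulrDl; apply: right_idealD => //; [apply: Ax | apply: Ay].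
  - by rewrite -mulrA; apply: Ax; apply: ideal_powMl.
have [|A' [_ [k EA] maxA]] := right_ideal_acc nR (Phi := fun B => exists k, B = A k).
  by exists (A 0%N); split; [case: (tA 0%N) | exists 0%N].
subst A'.
have AS : A k.+1 `<=` A k.
  apply: maxA; [by case: (tA k.+1) | by exists k.+1 |].
  by move=> x Ax p /ideal_powS; apply: Ax.
have nzA : nonzero_ideal (A k).
  split=> //; have [r [Ir r0]] := nzI; exists r; split=> // p _.
  exact: right_idealM.
have [AP|/(max_ideal_comaximal (tA k))[a [Aa Pa]]] := pselect (A k `<=` PE); last first.
  by exists k, a; split=> // p; apply: Aa.
case: max_ideal_proper; have [tP _] := max_ideal_nonzero.
apply: (cancel_left nzA tP) => x Ax.
have [J [PJ JP _ J1]] := ideal_inverse max_ideal_nonzero.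
have [||b c Pb Jc|r [/eqP]] :=
    J1 [set q | exists r, iota r = iota x * q /\ product (A k) PE r].
- by exists 0; rewrite rmorph0 mulr0; split=> //; apply: product0.
- move=> q q' [r [rE hr]] [r' [rE' hr']]; exists (r + r').
  by rewrite rmorphD mulrDr rE rE'; split=> //; apply: productD.
- have [r rE] := PJ x c (AP x Ax) Jc; exists (r * b).
  rewrite rmorphM rE mulrA; split=> //; apply: product_mem => //.
  apply: AS => p /ideal_pow_product hp.
  apply: (hp [set p | I (r * p)]) => /=.
  + by rewrite mulr0; apply: right_ideal0.
  + by move=> y z Iy Iz; rewrite mulrDr; apply: right_idealD.
  + move=> y z Py Pz; have [s sE] := JP y c Py Jc.
    have ry : r * y = x * s.
      by apply: iota_inj; rewrite !rmorphM rE sE mulrA.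
    rewrite mulrA ry; have [hA _] := tA k; exact: (right_idealM s hA Ax).
- by rewrite mulr1 => /eqP/iota_inj->.
Qed.

(** Mirror image of [coprime_right]. *)
Lemma coprime_left I : nonzero_ideal I -> exists k a, PE (1 - a) /\
  forall p, ideal_pow P k p -> I (p * a).
Proof.
move=> [[hI Il] nzI].
pose A k := [set r | forall p, ideal_pow P k p -> I (p * r)].
have tA k : two_sided (A k).
  split=> [|r x Ax p Pp]; last by rewrite mulrA; apply: Ax; apply: ideal_powMr.
  apply: right_idealP => [p _|x y Ax Ay p Pp|x r Ax p Pp].
  - by rewrite mulr0; apply: right_ideal0.
  - by rewrite mulrDr; apply: right_idealD => //; [apply: Ax | apply: Ay].
  - by rewrite mulrA; apply: right_idealM => //; apply: Ax.
have [|A' [_ [k EA] maxA]] := right_ideal_acc nR (Phi := fun B => exists k, B = A k).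
  by exists (A 0%N); split; [case: (tA 0%N) | exists 0%N].
subst A'.
have AS : A k.+1 `<=` A k.
  apply: maxA; [by case: (tA k.+1) | by exists k.+1 |].
  by move=> x Ax p /ideal_powS; apply: Ax.
have nzA : nonzero_ideal (A k).
  by split=> //; have [r [Ir r0]] := nzI; exists r; split=> // p _; apply: Il.
have [AP|/(max_ideal_comaximal (tA k))[a [Aa Pa]]] := pselect (A k `<=` PE); last first.
  by exists k, a; split=> // p; apply: Aa.
case: max_ideal_proper; have [tP _] := max_ideal_nonzero.
apply: (cancel_right nzA tP) => x Ax.
have [J [PJ JP J1 _]] := ideal_inverse max_ideal_nonzero.
have [||b c Pb Jc|r [/eqP]] :=
    J1 [set q | exists r, iota r = q * iota x /\ product PE (A k) r].
- by exists 0; rewrite rmorph0 mul0r; split=> //; apply: product0.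
- move=> q q' [r [rE hr]] [r' [rE' hr']]; exists (r + r').
  by rewrite rmorphD mulrDl rE rE'; split=> //; apply: productD.
- have [r rE] := JP x c (AP x Ax) Jc; exists (b * r).
  rewrite rmorphM rE mulrA; split=> //; apply: product_mem => //.
  apply: AS => p /mul_set_product hp.
  apply: (hp [set p | I (p * r)]) => /=.
  + by rewrite mul0r; apply: right_ideal0.
  + by move=> y z Iy Iz; rewrite mulrDl; apply: right_idealD.
  + move=> y z Py Pz; have [s sE] := PJ z c Pz Jc.
    have ry : z * r = s * x.
      by apply: iota_inj; rewrite !rmorphM rE sE mulrA.
    by rewrite -mulrA ry; apply: (tA k).2.
- by rewrite mul1r => /eqP/iota_inj->.
Qed.

(** [R / P] is a simple artinian ring; [U / P] is a minimal right ideal of it, and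
[Z] is the annihilator of the class of an element [u] of [U]. If [wru] is in [G] for
all [r], then [G] contains [wI] for the two-sided ideal [I] generated by [P]
and [u], which is [R]. *)
Lemma max_ideal_socle : exists Z : set R,
  [/\ right_ideal Z, ~ Z 1, forall p, PE p -> Z p,
   forall r, ~ Z r -> exists s, Z (1 - r * s)
 & forall (W : lmodType R^c) (G : set W) (w : W), is_submod G ->
     (forall p, PE p -> w ** p = 0) -> ~ G w ->
     exists r, ~ G (w ** r) /\ forall z, Z z -> w ** (r * z) = 0].
Proof.
have [[hP Pl] _] := max_ideal_nonzero.
have [|U [hU PU [u [Uu nPu]] minU]] := right_ideal_dcc hered nR nL hP
    (nonzero_ideal_essential prR max_ideal_nonzero)
    (Phi := fun A => exists x, A x /\ ~ PE x).
  by exists [set: R]; split=> //; exists 1; split=> //; apply: max_ideal_proper.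
exists [set r | PE (u * r)]; split.
- exact: (right_ideal_preim (M := R^c^o) u hP).
- by rewrite /= mulr1.
- by move=> p Pp; apply: Pl.
- move=> r nPr; have [|||y [s [Py uE]]] := minU _ (right_ideal_add_principal (u * r) hP) _ _ _ u Uu.
  + by move=> y Py; exists y, 0; rewrite mulr0 addr0.
  + exists (u * r); split=> //; exists 0, 1; rewrite mulr1 add0r.
    by split=> //; apply: right_ideal0.
  + move=> _ [y [s [Py ->]]]; apply: right_idealD => //; first exact: PU.
    by do 2! apply: right_idealM => //.
  exists s; rewrite /= mulrBr mulr1 mulrA {1}uE addrK //.
- move=> W G w hG wP nGw.
  have [[r nGr]|h] := pselect (exists r, ~ G (w ** (r * u))).
    exists (r * u); split=> // z Pz; rewrite -mulrA; apply: wP; exact: Pl.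
  case: nGw; have := @max_ideal_max [set t | forall r, G (w ** (r * t))].
  move=> maxI; rewrite -[w]ract1 -[1 : R]mulr1; apply: maxI => [|p Pp r|].
  + split=> [|r x Ix s]; last by rewrite mulrA; apply: Ix.
    apply: right_idealP => [r|x y Ix Iy r|x s Ix r].
    * by rewrite mulr0 ract0; apply: is_submod0.
    * by rewrite mulrDr ractDr; apply: is_submodD.
    * by rewrite mulrA -ractA; apply: is_submodZ.
  + by rewrite wP; [apply: is_submod0 | apply: Pl].
  + by exists u; split=> // r; apply: contrapT => n; apply: h; exists r.
Qed.

End MaximalIdeal.

Lemma exists_max_ideal I : nonzero_ideal I -> ~ I 1 ->
  exists P, maximal_invertible_ideal iota P /\ I `<=` [set x | x \in P].
Proof.
move=> [tI [r [Ir r0]]] nI1.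
have [|A [_ [tA nA1 IA] maxA]] := right_ideal_acc nR
    (Phi := fun A => [/\ two_sided A, ~ A 1 & I `<=` A]).
  by exists I; split; [case: tI | split].
have [P PE] := two_sided_ideal tA; exists P; split; last by move=> x /IA /PE.
split=> [|P' [_ P'T] PP' x].
  split; last by move=> PT; apply/nA1/PE; have : ideal_set P 1 by rewrite PT.
  by case: ded => _ _; apply => P0; case/eqP: r0; apply/P0/PE/IA.
apply/idP/idP => [P'x|]; last exact: PP'.
have [tP' P'l] := ideal_two_sided P'.
apply/PE; apply: (maxA [set x | x \in P']) => //.
- split=> // [P'1|y /IA/PE/PP' //].
  by apply: P'T; apply/seteqP; split=> // y _; rewrite -[y]mul1r; apply: ideal_mulr.
- by move=> y /PE/PP'.
Qed.

End DedekindPrime.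

(** * Combinations, sequences and Bassian quotients *)

(** Dependent choice where the condition on the next term involves the terms
already chosen. *)
Lemma greedy_sequence (T : Type) (x0 : T) (P : (nat -> T) -> nat -> T -> Prop) :
  (forall y n, exists x, P y n x) ->
  (forall y y' n x, (forall i, (i < n)%N -> y i = y' i) -> P y n x -> P y' n x) ->
  exists y, forall n, P y n (y n).
Proof.
move=> exP extP.
have /choice[h hP] (l : seq T) : exists x, P (nth x0 l) (size l) x by apply: exP.
pose L := fix L n := if n is m.+1 then rcons (L m) (h (L m)) else [::].
have sizeL n : size (L n) = n by elim: n => //= n IHn; rewrite size_rcons IHn.
have nthL n i : (i < n)%N -> nth x0 (L n) i = h (L i).
  elim: n => // n IHn; rewrite ltnS leq_eqVlt /= nth_rcons sizeL => /orP[/eqP->|i_n].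
    by rewrite ltnn eqxx.
  by rewrite i_n IHn.
exists (fun n => h (L n)) => n; have := hP (L n); rewrite sizeL.
by apply: extP => i i_n; rewrite nthL.
Qed.

Section Combinations.
Variables (S : nzRingType) (M : lmodType S).

Definition comb (y : nat -> M) n (c : nat -> S) : M := \sum_(i < n) c i *: y i.

(** One pair [m], [d] serves for every sequence [y], so that linear relations
between combinations of two sequences can be compared; [K] keeps track of
coefficients in an ideal. *)
Lemma comb_linear (K : set S) a n c n' c' : is_submod (K : set S^o) ->
  (forall i, K (c i)) -> (forall i, K (c' i)) ->
  exists m d, (forall i, K (d i)) /\
    forall y, comb y m d = a *: comb y n c + comb y n' c'.
Proof.
move=> hK Kc Kc'.
pose w (k : nat) (b : nat -> S) i := if (i < k)%N then b i else 0.
have wE k b m y : (k <= m)%N -> comb y m (w k b) = comb y k b.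
  move=> km; rewrite /comb (big_ord_widen m (fun i => b i *: y i)) // [RHS]big_mkcond.
  by apply: eq_bigr => i _; rewrite /w; case: ifP; rewrite ?scale0r.
exists (maxn n n'), (fun i => a * w n c i + w n' c' i); split.
  by move=> i; apply: (hK.2 a); rewrite /w; case: ifP => // _; apply: (is_submod0 hK).
move=> y; rewrite -(wE n c _ y (leq_maxl n n')) -(wE n' c' _ y (leq_maxr n n')).
rewrite /comb scaler_sumr -big_split /=.
by apply: eq_bigr => i _; rewrite scalerDl scalerA.
Qed.

Lemma is_submod_lspan_union y : is_submod [set x : M | exists n, lspan y n x].
Proof.
split=> [|a _ _ [n [c ->]] [n' [c' ->]]].
  by exists 0%N; apply: is_submod0; apply: is_submod_lspan.
have [m [d [_ dE]]] := @comb_linear setT a n c n' c' (@is_submodT _ _) (fun=> I) (fun=> I).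
by exists m, d; rewrite -/(comb y m d) dE.
Qed.

End Combinations.

Section BassianQuotients.
Variables (S : nzRingType) (M : lmodType S).

Lemma super_bassian_bassian : super_bassian M -> bassian M.
Proof. by move=> /(_ M idfun); apply => y; exists y. Qed.

Lemma super_bassian_quotient (N : submodClosed M) :
  super_bassian M -> super_bassian (quotient_module N).
Proof.
move=> sbM M' p psurj.
apply: (sbM M' (p \o (proj N : {linear M -> quotient_module N}))) => y.
have [x <-] := psurj y; have [z <-] := proj_surj x; by exists z.
Qed.

End BassianQuotients.

(** * Primary modules *)

Section Primary.
Variables (R : nzRingType) (Q : unitRingType) (iota : {rmorphism R -> Q}).
Hypothesis ded : dedekind_prime_ring iota.
Variable P : ideal R.
Hypothesis maxP : maximal_invertible_ideal iota P.
Implicit Types (A B E I : set R) (a b r s : R).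

Let hnpR : hnp_ring R. Proof. by case: ded. Qed.
Let hered : left_hereditary R^c. Proof. by case: hnpR => -[]. Qed.
Let nR : noetherian R^c^o. Proof. by case: hnpR => _ []. Qed.
Let prR : prime_ring R. Proof. by case: hnpR. Qed.
Let iota_inj : injective iota. Proof. by case: ded => _ []. Qed.

Definition primary (Y : lmodType R^c) : Prop :=
  forall y : Y, exists n, forall p, ideal_pow P n p -> y ** p = 0.

(** The submodule [YP]. *)
Definition times_ideal (Y : lmodType R^c) : set Y :=
  [set y | forall K : set Y, K 0 -> (forall x z, K x -> K z -> K (x + z)) ->
     (forall (x : Y) p, p \in P -> K (x ** p)) -> K y].

Lemma is_submod_times_ideal Y : is_submod (@times_ideal Y).
Proof.
split=> [K K0 _ _ //|a x y hx hy K K0 KD KM].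
apply: (KD); last exact: hy.
apply: (hx [set x | K (a *: x)]) => /= [|z t Kz Kt|z p Pp].
- by rewrite scaler0.
- by rewrite scalerDr; apply: KD.
- by rewrite ractA; apply: KM; apply: ideal_mulr.
Qed.

(** [D = DP]; over the integers, divisibility by a prime number. *)
Definition divisible (D : lmodType R^c) : Prop := forall d : D, times_ideal d.

Lemma divisible_pow (D : lmodType R^c) m (K : set D) : divisible D ->
  K 0 -> (forall x z, K x -> K z -> K (x + z)) ->
  (forall (x : D) p, ideal_pow P m p -> K (x ** p)) -> forall d, K d.
Proof.
move=> divD; elim: m K => [|m IHm] K K0 KD KM d.
  by rewrite -[d]ract1; apply: KM.
apply: divD => // x p Pp; apply: (IHm [set y | K (y ** p)]) => /=.
- by rewrite scaler0.
- by move=> y z Ky Kz; rewrite ractDl; apply: KD.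
- by move=> y q Pq; rewrite ractA; apply: KM; apply: ideal_powM.
Qed.

Lemma ideal_pow_nonzero m : nonzero_ideal (ideal_pow P m).
Proof.
split.
  split; last by move=> r x; apply: ideal_powMl.
  apply: right_idealP; [exact: ideal_pow0 | exact: ideal_powD |].
  by move=> x r; apply: ideal_powMr.
have [_ [p [Pp p0]]] := max_ideal_nonzero maxP.
elim: m => [|m [q [Pq q0]]]; first by exists 1; rewrite oner_neq0.
have [s qsp] := prime_ring_elt prR q0 p0; exists (q * s * p); split=> //.
by apply: ideal_powM => //; apply: ideal_powMr.
Qed.

(** In the ring of fractions [phi] is multiplication by some [q], with
[Bq <= R] as [B <= E]; then [r = bq]. *)
Lemma baer_coefficient B E (phi : R -> R) b : nonzero_ideal B -> right_ideal E ->
  B `<=` E -> rlin_on E phi -> B b ->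
  exists r, forall e, E e -> r * e = b * phi e.
Proof.
move=> nzB hE BE hphi Bb; have [[hB Bl] [b0 [Bb0 nzb0]]] := nzB.
have [J [BJ JB J1 _]] := ideal_inverse ded nzB.
have [||c q Bc Jq|r rP] := J1 [set q | exists r, forall y, B y ->
    exists t, [/\ E t, iota t = q * iota y & r * y = b * phi t]].
- exists 0 => y By; exists 0; rewrite rmorph0 !mul0r (rlin_on0 hE hphi) mulr0.
  by split=> //; apply: right_ideal0.
- move=> q q' [r rP] [r' rP']; exists (r + r') => y By.
  have [t [Et tE rt]] := rP y By; have [t' [Et' tE' rt']] := rP' y By.
  exists (t + t'); rewrite rmorphD !mulrDl tE tE' rt rt' -mulrDr.
  split=> //; first exact: right_idealD.
  by rewrite -{2}[t]mulr1 hphi // mulr1.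
- have [r rE] := BJ (b * phi c) q (right_idealM _ hB Bb) Jq.
  exists r => y By; have [s sE] := JB y q By Jq; exists (c * s); split.
  + by apply: BE; apply: right_idealM.
  + by rewrite rmorphM sE mulrA.
  + apply: iota_inj; rewrite (rlin_onM _ hE hphi) ?mulrA; last exact: BE.
    by rewrite !(rmorphM iota r) rE -mulrA -sE -rmorphM.
(* So [r y = b phi(y)] on [B], and the difference on [E] is annihilated by [B]. *)
exists r => e Ee.
have reB y : B y -> (r * e - b * phi e) * y = 0.
  move=> By; have [t [Et tE rt]] := rP (e * y) (Bl e y By).
  move: tE; rewrite mul1r => /iota_inj tE; rewrite mulrBl -!mulrA rt tE.
  by rewrite (rlin_onM _ hE hphi) ?subrr.
apply/eqP; rewrite -subr_eq0; apply: contrapT => /negP nz.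
have [s /eqP] := prime_ring_elt prR nz nzb0; apply.
by rewrite -mulrA; apply: reB; apply: Bl.
Qed.

(** Baer's criterion for the right ideals that contain a power of [P]. With a
dual basis, [psi e] is the sum of the [psi (g k) * phi k e], and each
[psi (g k)] is a sum of terms [db] with [b] in [P ^ m]; by
[baer_coefficient], [db * phi k e = d r e] for some [r]. *)
Lemma baer_divisible (D : lmodType R^c) m E (psi : R -> D) : divisible D ->
  right_ideal E -> ideal_pow P m `<=` E ->
  (forall x y r, E x -> E y -> psi (x * r + y) = psi x ** r + psi y) ->
  exists d, forall e, E e -> psi e = d ** e.
Proof.
move=> divD hE PE hpsi; have [n [g [phi [Eg hphi phiE]]]] := dual_basis hered nR hE.
have psi0 : psi 0 = 0.
  have := hpsi 0 0 (-1) (right_ideal0 hE) (right_ideal0 hE).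
  by rewrite mul0r addr0 scaleN1r addNr.
have /choice[d dP] (k : nat) : exists d, forall e, E e -> d ** e = psi (g k) ** phi k e.
  move: (psi (g k)); apply: (divisible_pow (m := m) divD).
  - by exists 0 => e _; rewrite !scaler0.
  - move=> x z [d dP] [d' dP']; exists (d + d') => e Ee.
    by rewrite !ractDl dP // dP'.
  - move=> x b Pb; have [r rP] := baer_coefficient (ideal_pow_nonzero m) hE PE (hphi k) Pb.
    by exists (x ** r) => e Ee; rewrite !ractA rP.
exists (\sum_(k < n) d k) => e Ee; rewrite {1}(phiE e Ee) scaler_sumr.
transitivity (\sum_(k < n) psi (g k) ** phi k e); last by apply: eq_bigr => k _; rewrite dP.
elim: n Eg {phiE} => [|n IHn] Eg; first by rewrite !big_ord0.
have Eg' i : (i < n)%N -> E (g i) by move=> i_n; apply/Eg/ltnW.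
rewrite !big_ord_recr /= addrC hpsi ?IHn 1?addrC //; first exact: Eg.
by apply: right_ideal_sum => // i _; apply: right_idealM => //; apply: Eg'.
Qed.

(** Partial homomorphisms are submodules of [X * D] meeting [0 * D] trivially. A
maximal one is everywhere defined by Baer's criterion, which applies because
the domain, seen from any element of [X], contains a power of [P]. *)
Lemma primary_extension (X D : lmodType R^c) (G : set (X * D)) :
  primary X -> divisible D -> is_submod G -> (forall d, G (0, d) -> d = 0) ->
  exists f : {linear X -> D}, forall x d, G (x, d) -> f x = d.
Proof.
move=> prX divD hG G0.
have hA : is_submod [set z : X * D | z.1 = 0].
  by split=> // a x y /= x0 y0; rewrite x0 y0 scaler0 addr0.
have [C [hC GC CA maxC]] := pseudo_complement hG hA.
have C0 d : C (0, d) -> d = 0 by move=> Cd; apply/G0/CA.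
have Cfun x d d' : C (x, d) -> C (x, d') -> d = d'.
  move=> Cd Cd'; apply/eqP; rewrite -subr_eq0; apply/eqP/C0.
  by have := is_submodB hC Cd Cd'; rewrite -[_ - _]/(x - x, d - d') subrr.
have [|f fP] := linear_of_relation hC _ C0; last first.
  by exists f => x d /GC/fP.
move=> x.
pose E := [set r : R | exists d, C (x ** r, d)].
have hE : right_ideal E.
  apply: right_idealP => [|r s [d Cd] [d' Cd']|r s [d Cd]].
  - by exists 0; rewrite ract0; apply: (is_submod0 hC).
  - by exists (d + d'); rewrite ractDr; apply: (is_submodD hC Cd Cd').
  - by exists (d ** s); rewrite -ractA; have := is_submodZ (s : R^c) hC Cd.
have /choice[psi psiP] (r : R) : exists d, E r -> C (x ** r, d).
  by have [[d Cd]|nE] := pselect (E r); [exists d | exists 0].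
have [m xm] := prX x.
have [|a b r Ea Eb|d0 d0P] := @baer_divisible D m E psi divD hE.
- by move=> p /xm xp; exists 0; rewrite xp; apply: (is_submod0 hC).
- apply: (Cfun (x ** (a * r + b))).
    by apply: psiP; apply: right_idealD => //; apply: right_idealM.
  by rewrite ractDr -ractA; apply: (hC.2 r _ _ (psiP a Ea) (psiP b Eb)).
exists d0; apply: maxC => r [c d] Cc.
rewrite -[_ *: _ + _]/(x ** r + c, d0 ** r + d) /= => /eqP; rewrite addr_eq0 => /eqP xr.
have Cr : C (x ** r, - d) by rewrite xr; apply: (is_submodN hC Cc).
have Er : E r by exists (- d).
rewrite xr addNr -d0P // (Cfun _ _ _ (psiP r Er) Cr) addNr; exact: (is_submod0 hG).
Qed.

Lemma primary_quotient (Y : lmodType R^c) (N : submodClosed Y) :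
  primary Y -> primary (quotient_module N).
Proof.
move=> prY x; have [y <-] := proj_surj x; have [n yn] := prY y.
by exists n => p /yn yp; rewrite -[LHS]linearZ [_ *: _]yp linear0.
Qed.

Lemma divisible_quotient (Y : lmodType R^c) (N : submodClosed Y) :
  divisible Y -> divisible (quotient_module N).
Proof.
move=> divY x K K0 KD KM; have [y <-] := proj_surj x.
apply: (divY y [set y | K (proj N y)]) => /= [|z t Kz Kt|z p Pp].
- by rewrite linear0.
- by rewrite linearD; apply: KD.
- by rewrite linearZ; apply: KM.
Qed.

Lemma primary_killed (Y : lmodType R^c) (y : Y) n : y != 0 ->
  (forall p, ideal_pow P n p -> y ** p = 0) ->
  exists r : R, y ** r != 0 /\ forall p, p \in P -> y ** (r * p) = 0.
Proof.
move=> y0; elim: n => [|n IHn] yn.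
  by case/eqP: y0; rewrite -[y]ract1; apply: yn.
have [[p [Pp yp]]|h] := pselect (exists p, ideal_pow P n p /\ y ** p != 0).
  by exists p; split=> // q Pq; apply: yn; apply: ideal_powM.
apply: IHn => p Pp; apply/eqP; apply: contrapT => /negP yp; apply: h; by exists p.
Qed.

(** A module over the simple artinian ring [R / P] that is not finitely generated
contains an infinite independent sequence [s] of isomorphic simple submodules,
with a complement [C]. The map that fixes [C] and sends [s i] to [s (i + 1)]
embeds [W] in [W / s 0 R]. *)
Lemma bassian_killed_fg (W : lmodType R^c) :
  (forall (w : W) p, p \in P -> w ** p = 0) -> bassian W -> fg_on [set: W].
Proof.
move=> WP basW; apply: contrapT => nfg.
have [Z [hZ Z1 PZ maxZ socZ]] := max_ideal_socle ded maxP.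
have [||s sP] := @greedy_sequence W 0 (fun y n x => ~ lspan y n x /\ forall z, Z z -> x ** z = 0).
- move=> y n; have [w nw] : exists w, ~ lspan y n w.
    apply: contrapT => h; apply: nfg; exists y, n; apply/seteqP; split=> // x _.
    by apply: contrapT => nx; apply: h; exists x.
  have [r [nr rZ]] := socZ W _ w (is_submod_lspan y n) (WP w) nw.
  by exists (w ** r); split=> // z /rZ; rewrite -ractA.
- move=> y y' n x yy' [nx xZ]; split=> // -[c xE]; apply: nx; exists c; rewrite xE.
  by apply: eq_bigr => i _; rewrite yy'.
have sZ i z : Z z -> s i ** z = 0 by move=> Zz; apply: (sP i).2.
have free n c : comb s n c = 0 -> forall i, (i < n)%N -> Z (c i).
  elim: n => // n IHn; rewrite /comb big_ord_recr /= => sum0.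
  have Zn : Z (c n).
    apply: contrapT => /maxZ[u Zu]; apply: (sP n).1.
    rewrite (ract_fix (sZ n _ Zu)) -ractA.
    apply: is_submodZ; first exact: is_submod_lspan.
    move/eqP: sum0; rewrite addrC addr_eq0 => /eqP->.
    by apply: is_submodN; [exact: is_submod_lspan | exists c].
  move=> i; rewrite ltnS leq_eqVlt => /orP[/eqP->//|]; apply: IHn.
  by move: sum0; rewrite sZ // addr0.
pose A := [set x | exists n, lspan s n x].
have hA : is_submod A by apply: is_submod_lspan_union.
have [C [hC _ CA maxC]] := pseudo_complement (@is_submod_zero _ W) hA.
have CA0 c : C c -> A c -> c = 0 by move=> Cc Ac; apply: CA.
(* [C + A] is everything: otherwise it misses some [wr] annihilated by [Z], which
   generates a simple module meeting [C + A] in zero, against maximality. *)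
have CAT w : exists c n k, C c /\ w = c + comb s n k.
  pose CpA := [set x | exists y z, [/\ C y, A z & x = y + z]].
  have hCA : is_submod CpA by apply: is_submod_add.
  have [[c [_ [Cc [n [k ->]] ->]]]|nw] := pselect (CpA w); first by exists c, n, k.
  have [r [nr rZ]] := socZ W _ w hCA (WP w) nw.
  suff Cwr : C (w ** r).
    case: nr; exists (w ** r), 0; rewrite addr0; split=> //; exact: is_submod0.
  apply: maxC => t c Cc Atc /=; have [Zt|/maxZ[u Zu]] := pselect (Z t).
    move: Atc; rewrite ractA rZ // add0r => Ac; exact: CA0.
  have fix_wr : w ** r ** (1 - (t : R) * u) = 0 by rewrite ractA rZ.
  case: nr; rewrite (ract_fix fix_wr) -ractA.
  apply: is_submodZ => //; exists (- c), (t *: (w ** r) + c); split=> //.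
    exact: is_submodN.
  by rewrite addrCA addNr addr0.
have hN := is_submod_lspan s 1.
pose W' : lmodType R^c := quotient_module (set_submod hN).
pose p : {linear W -> W'} := proj (set_submod hN).
have p0 x : p x = 0 <-> lspan s 1 x by rewrite proj_eq0; apply: in_set_submod.
pose s' i := s i.+1.
pose G := [set z : W * W' | exists c n k,
  [/\ C c, z.1 = c + comb s n k & z.2 = p (c + comb s' n k)]].
have zeroC c n (k : nat -> R^c) : C c -> c + comb s n k = 0 -> c = 0 /\ comb s n k = 0.
  move=> Cc ck0; have c0 : c = 0.
    apply: CA0 => //; move/eqP: ck0; rewrite addr_eq0 => /eqP->.
    by apply: is_submodN => //; exists n, k.
  by move: ck0; rewrite c0 add0r.
have [|||f fP] := @linear_of_relation _ W W' G.
- split.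
    exists 0, 0%N, (fun=> 0); split; first exact: is_submod0.
      by rewrite /comb big_ord0 addr0.
    by rewrite /comb big_ord0 addr0 (linear0 p).
  move=> a [_ _] [_ _] [c [n [k [Cc /= -> ->]]]] [c' [n' [k' [Cc' /= -> ->]]]].
  have [m [d [_ dE]]] := @comb_linear _ W setT a n k n' k' (@is_submodT _ _) (fun=> I) (fun=> I).
  exists (a *: c + c'), m, d; split; first exact: hC.2.
    by rewrite /= dE scalerDr addrACA.
  by rewrite /= dE -linearP; congr (p _); rewrite scalerDr addrACA.
- by move=> w; have [c [n [k [Cc ->]]]] := CAT w; exists (p (c + comb s' n k)), c, n, k.
- move=> v [c [n [k [Cc /= /esym]]]] /(zeroC _ _ _ Cc)[-> /free kZ] ->.
  rewrite add0r /comb big1 ?linear0 // => i _; exact/sZ/kZ.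
suff N0 : zero_submodule (set_submod hN).
  have s0 : s 0%N = 0.
    by apply: N0; apply/in_set_submod; apply: lspan_mem.
  by case: (sP 0%N) => []; rewrite s0; case; apply: is_submod0; apply: is_submod_lspan.
apply: basW; exists f; apply: raddf_inj => w fw.
have [c [n [k [Cc wE]]]] := CAT w.
have : f w = p (c + comb s' n k) by apply/fP; exists c, n, k.
rewrite fw => /esym/p0[k0]; rewrite big_ord_recl big_ord0 addr0 /= => ck.
(* [f w = 0] is a relation with [-k0] in front, to which freeness applies. *)
pose k' i := if i is j.+1 then k j else - k0 0%N.
have combk' : c + comb s n.+1 k' = 0.
  by rewrite /comb big_ord_recl /= addrCA [X in _ + X]ck scaleNr addNr.
have [c0 /free k'Z] := zeroC _ _ _ Cc combk'.
rewrite wE c0 add0r /comb big1 // => i _; apply: sZ; exact: (k'Z i.+1 (ltn_ord i)).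
Qed.

(** A nonzero [D] contains a simple module [S = sR]. In a quotient [D1] of [D] where
the image of [S] is essential, [D1 / S] is divisible and nonzero, so it has an
element [t] with the same annihilator as [s]; the homomorphism [s |-> t]
extends to [D1] by injectivity of [D1 / S], and it is injective because [S] is
essential. This is how the Pruefer group embeds in its quotient by its socle. *)
Lemma divisible_super_bassian (D : lmodType R^c) :
  primary D -> divisible D -> super_bassian D -> forall d : D, d = 0.
Proof.
move=> prD divD sbD d; apply/eqP; apply: contrapT => /negP d0.
have [Z [hZ Z1 PZ maxZ socZ]] := max_ideal_socle ded maxP.
have soc (Y : lmodType R^c) (y : Y) : primary Y -> y != 0 ->
    exists s : Y, s != 0 /\ forall z, Z z -> s ** z = 0.
  move=> prY y0; have [n yn] := prY y; have [r [yr0 yrP]] := primary_killed y0 yn.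
  have [|||t [nt tZ]] := socZ Y [set 0] (y ** r); first exact: is_submod_zero.
  - by move=> p Pp; rewrite ractA yrP.
  - by move/eqP: yr0.
  exists (y ** r ** t); split; first by apply/eqP => yrt; apply: nt.
  by move=> z Zz; rewrite [LHS]ractA tZ.
have killZ (Y : lmodType R^c) (y : Y) r : (forall z, Z z -> y ** z = 0) -> y != 0 ->
    y ** r = 0 -> Z r.
  move=> yZ /eqP y0 yr; apply: contrapT => /maxZ[u Zu]; apply: y0.
  by rewrite (ract_fix (yZ _ Zu)) -ractA yr scaler0.
have line (Y : lmodType R^c) (y : Y) : is_submod [set x | exists r : R, x = y ** r].
  split=> [|a _ _ [r ->] [r' ->]]; first by exists 0; rewrite ract0.
  by exists (r * a + r'); rewrite ractDr ractA.
have [s [s0 sZ]] := soc D d prD d0.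
have [K [hK _ KS maxK]] := pseudo_complement (@is_submod_zero _ D) (line D s).
pose D1 : lmodType R^c := quotient_module (set_submod hK).
pose p : {linear D -> D1} := proj (set_submod hK).
have p0 x : p x = 0 <-> K x by rewrite proj_eq0; apply: in_set_submod.
pose s1 := p s.
have ps r : s1 ** r = p (s ** r) by rewrite [RHS]linearZ.
have prD1 : primary D1 by apply: primary_quotient.
have divD1 : divisible D1 by apply: divisible_quotient.
have s10 : s1 != 0.
  apply/eqP => /p0 Ks; case/eqP: s0; apply: KS; split=> //; exists 1; by rewrite ract1.
have s1Z z : Z z -> s1 ** z = 0 by move=> Zz; rewrite ps sZ // linear0.
have essS x : x != 0 -> exists r r' : R, x ** r = s1 ** r' /\ s1 ** r' != 0.
  have [y <-] := proj_surj x => /eqP y0.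
  have nKy : ~ K y by move=> /p0.
  apply: contrapT => h; apply: nKy; apply: maxK => r c Kc [r' yr] /=.
  apply: contrapT => /eqP yr0; apply: h; exists r, r'; split.
    rewrite ps -yr linearD [X in _ + X](_ : _ = 0) ?addr0; last exact/p0.
    by rewrite linearZ.
  apply/eqP; rewrite ps => /p0 Ks; case/eqP: yr0; apply: KS; split; first by rewrite yr.
  by exists r'.
have hN := line D1 s1.
pose D2 : lmodType R^c := quotient_module (set_submod hN).
pose q : {linear D1 -> D2} := proj (set_submod hN).
have q0 x : q x = 0 <-> exists r : R, x = s1 ** r by rewrite proj_eq0; apply: in_set_submod.
(* [D1] is not [S], as [S P = 0] while [D1 P = D1]. *)
have [y y0] : exists y : D2, y != 0.
  apply: contrapT => h; case/eqP: s10.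
  apply: (divD1 s1 [set 0]) => //= [x z -> ->|x t Pt]; first by rewrite addr0.
  have /q0[r ->] : q x = 0.
    by apply/eqP; apply: contrapT => /negP qx; apply: h; exists (q x).
  by rewrite ractA s1Z //; apply: PZ; apply: ideal_mull.
have [t [t0 tZ]] := soc D2 y (primary_quotient prD1) y0.
have [|||f fP] := @primary_extension D1 D2 [set z | exists r : R, z = (s1 ** r, t ** r)] prD1.
- exact: divisible_quotient.
- split=> [|a _ _ [r ->] [r' ->]]; first by exists 0; rewrite !ract0.
  by exists (r * a + r'); rewrite !ractDr -!ractA.
- by move=> e [r [/esym/(killZ _ _ _ s1Z s10) Zr ->]]; apply: tZ.
suff N0 : zero_submodule (set_submod hN).
  by case/eqP: s10; apply: N0; apply/in_set_submod; exists 1; rewrite ract1.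
apply: (super_bassian_bassian (super_bassian_quotient (N := set_submod hK) sbD)).
exists f; apply: raddf_inj => x fx; apply/eqP; apply: contrapT => /negP x0.
have [r [r' [xr s1r']]] := essS x x0.
have ftr : f (s1 ** r') = t ** r' by apply: fP; exists r'.
have : t ** r' = 0 by rewrite -ftr -xr linearZ [f x]fx; exact: (scaler0 D2 r).
by move=> /(killZ _ _ _ tZ t0) Zr'; case/eqP: s1r'; apply: s1Z.
Qed.

(** [Y / YP] is finitely generated; lifting generators gives [Y = G + YP], and
[Y / G] is divisible, hence zero. *)
Lemma primary_super_bassian_acc (Y : lmodType R^c) :
  primary Y -> super_bassian Y -> acc_on [set: Y].
Proof.
move=> prY sbY; have hYP := is_submod_times_ideal Y.
pose W : lmodType R^c := quotient_module (set_submod hYP).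
pose p : {linear Y -> W} := proj (set_submod hYP).
have p0 x : p x = 0 <-> times_ideal x by rewrite proj_eq0; apply: in_set_submod.
have basW : bassian W.
  exact: (super_bassian_bassian (super_bassian_quotient (N := set_submod hYP) sbY)).
have [|w [n wE]] := @bassian_killed_fg W _ basW.
  move=> w r Pr; have [y <-] := proj_surj w; rewrite -[LHS]linearZ.
  by apply/p0 => K _ _; apply.
have /choice[g gE] (i : nat) : exists y, p y = w i by apply: proj_surj.
have hG := is_submod_lspan g n.
pose D : lmodType R^c := quotient_module (set_submod hG).
pose q : {linear Y -> D} := proj (set_submod hG).
have q0 x : q x = 0 <-> lspan g n x by rewrite proj_eq0; apply: in_set_submod.
have D0 : forall d : D, d = 0.
  apply: divisible_super_bassian; [exact: primary_quotient | | exact: super_bassian_quotient].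
  move=> d K K0 KD KM; have [y <-] := proj_surj d.
  have [c cE] : lspan w n (p y) by rewrite -wE.
  pose z := \sum_(i < n) c i *: g i.
  have qz : q z = 0 by apply/q0; exists c.
  have -> : proj (set_submod hG) y = q (y - z) by rewrite linearB qz subr0.
  have : times_ideal (y - z).
    apply/p0; rewrite linearB cE linear_sum -sumrB big1 // => i _.
    by rewrite linearZ /= gE subrr.
  move=> /(_ [set x | K (q x)]); apply => /= [|x x' Kx Kx'|x r Pr].
  - by rewrite linear0.
  - by rewrite linearD; apply: KD.
  - by rewrite linearZ; apply: KM.
have -> : [set: Y] = lspan g n by apply/seteqP; split=> // x _; apply/q0/D0.
exact: acc_on_lspan.
Qed.

End Primary.

(** * Torsion modulo a submodule *)

Section Torsion.
Variables (R : nzRingType) (Q : unitRingType) (iota : {rmorphism R -> Q}).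
Hypothesis ded : dedekind_prime_ring iota.
Hypothesis npR : non_primitive R.

Let hnpR : hnp_ring R. Proof. by case: ded. Qed.
Let nR : noetherian R^c^o. Proof. by case: hnpR => _ []. Qed.
Let prR : prime_ring R. Proof. by case: hnpR. Qed.

Section Closure.
Variable M : lmodType R^c.
Implicit Types (A B : set M) (x y : M) (P : ideal R).

(** The elements whose image in [M / A] is annihilated by a nonzero two-sided
ideal, namely the one generated by [r]. *)
Definition torsion_closure A : set M :=
  [set x | exists r : R, r != 0 /\ forall t : R, A (x ** (t * r))].

Local Notation cl := torsion_closure.

Lemma is_submod_closure A : is_submod A -> is_submod (cl A).
Proof.
move=> hA; split.
  by exists 1; rewrite oner_neq0; split=> // t; rewrite scaler0; apply: is_submod0.
move=> a x y [r [r0 xr]] [r' [r0' yr]]; have [s rsr] := prime_ring_elt prR r0 r0'.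
exists (r * s * r'); split=> // t; rewrite ractDl; apply: is_submodD => //.
  rewrite ractA (_ : _ * _ = ((a : R) * t * r) * (s * r')); last by rewrite !mulrA.
  by rewrite -ractA; apply: is_submodZ.
by rewrite mulrA; apply: yr.
Qed.

Lemma closure_sub A : is_submod A -> A `<=` cl A.
Proof.
by move=> hA x Ax; exists 1; rewrite oner_neq0; split=> // t; apply: is_submodZ.
Qed.

Lemma closure_mono A B : A `<=` B -> cl A `<=` cl B.
Proof. by move=> AB x [r [r0 xr]]; exists r; split=> // t; apply: AB. Qed.

Lemma closure_uniform A (y : nat -> M) n : is_submod A ->
  (forall i, (i < n)%N -> cl A (y i)) ->
  exists r : R, r != 0 /\ forall i, (i < n)%N -> forall t : R, A (y i ** (t * r)).
Proof.
move=> hA; elim: n => [|n IHn] yA; first by exists 1; rewrite oner_neq0.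
have [|r [r0 rP]] := IHn; first by move=> i i_n; apply/yA/ltnW.
have [r' [r0' rP']] := yA n (ltnSn n); have [s rsr] := prime_ring_elt prR r0 r0'.
exists (r * s * r'); split=> // i; rewrite ltnS leq_eqVlt => /orP[/eqP->|i_n] t.
  by rewrite mulrA; apply: rP'.
by rewrite -mulrA mulrA -ractA; apply: is_submodZ => //; apply: rP.
Qed.

Definition annihilator_mod A x : set R := [set r | forall t : R, A (x ** (t * r))].

Lemma annihilator_mod_nonzero A x : is_submod A -> cl A x ->
  nonzero_ideal (annihilator_mod A x).
Proof.
move=> hA [r [r0 xr]]; split; last by exists r.
split=> [|s y Ay t]; last by rewrite mulrA.
apply: right_idealP => [t|y z Ay Az t|y s Ay t].
- by rewrite mulr0 ract0; apply: is_submod0.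
- by rewrite mulrDr ractDr; apply: is_submodD.
- by rewrite mulrA -ractA; apply: is_submodZ.
Qed.

(** The ideal [I] of the [s] that send [x] into the closure of [A] is finitely
generated on the right, so that one [u] works for all its generators. *)
Lemma closure_idem A : is_submod A -> cl (cl A) `<=` cl A.
Proof.
move=> hA x /(annihilator_mod_nonzero (is_submod_closure hA)).
move=> [[hI Il] [r [Ir r0]]].
have [g [n [Ig gE]]] := right_ideal_fg nR hI.
have [i i_n|u [u0 uP]] := @closure_uniform A (fun i => x ** g i) n hA.
  by have := Ig i i_n 1; rewrite mul1r.
have [s rsu] := prime_ring_elt prR r0 u0; exists (r * s * u); split=> // t.
have [c cE] := gE (t * r * s) (right_idealM s hI (Il t r Ir)).
rewrite mulrA mulrA cE mulr_suml.
have -> : x ** (\sum_(i < n) g i * c i * u) = \sum_(i < n) x ** (g i * c i * u).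
  exact: (scaler_suml (R := R^c)).
apply: is_submod_sum => // i _; rewrite -mulrA -ractA; exact: uP.
Qed.

Section AtMaximalIdeal.
Variable P : ideal R.
Hypothesis maxP : maximal_invertible_ideal iota P.

(** [x = xa + x(1 - a)], where modulo [A] the first term is annihilated by a power
of [P]; the second one lies in [x P^m]. *)
Lemma torsion_split_right A x m : is_submod A -> cl A x ->
  exists (a : R) k, ideal_pow P m (1 - a) /\ forall p, ideal_pow P k p -> A (x ** (a * p)).
Proof.
move=> hA /(annihilator_mod_nonzero hA) nzI.
have [k [a [Pa aI]]] := coprime_right ded maxP nzI.
have [a' [Pa' [c ac] _]] := coprime_pow m Pa.
by exists a', k; split=> // p /aI /(_ c); rewrite mulrA -ac.
Qed.

(** Every element of [x P^k] is annihilated modulo [A] by the ideal generated by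
[a], which is comaximal with [P]. *)
Lemma torsion_split_left A x : is_submod A -> cl A x ->
  exists (a : R) k, 1 - a \in P /\
    forall p t : R, ideal_pow P k p -> A (x ** (p * t * a)).
Proof.
move=> hA /(annihilator_mod_nonzero hA) nzI.
have [k [a [Pa aI]]] := coprime_left ded maxP nzI.
exists a, k; split=> // p t Pp.
by have := aI (p * t) (ideal_powMr _ Pp) 1; rewrite mul1r.
Qed.

Definition primary_part A : set M :=
  [set x | exists n, forall p, ideal_pow P n p -> A (x ** p)].

Lemma is_submod_primary_part A : is_submod A -> is_submod (primary_part A).
Proof.
move=> hA; split=> [|a x y [n xn] [m ym]].
  by exists 0%N => p _; rewrite scaler0; apply: is_submod0.
exists (n + m)%N => p Pp; rewrite ractDl; apply: is_submodD => //.
  rewrite ractA; apply: xn; apply: ideal_powMl.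
  by apply: ideal_pow_le Pp; rewrite leq_addr.
by apply: ym; apply: ideal_pow_le Pp; rewrite leq_addl.
Qed.

End AtMaximalIdeal.

End Closure.

Local Notation cl := torsion_closure.

(** * Noetherian primary parts imply Bassian *)

(** The finiteness conditions on [M] relative to [H], stated inside [M]: the
submodule [primary_part P H] is the preimage of a primary component of [M / H]. *)
Definition primary_noetherian (M : lmodType R^c) (H : set M) : Prop :=
  [/\ is_submod H, acc_on H, forall x, cl H x &
      forall P, maximal_invertible_ideal iota P -> acc_on (primary_part P H)].

(** The primary part of an image is the image of the primary part: if [q x P^n] is
in [q H], then [x] is the sum of an element of the primary part and of an
element of [x P^n], by [torsion_split_right]. *)
Lemma primary_noetherian_image (M M' : lmodType R^c) (q : {linear M -> M'}) H :
  (forall y, exists x, q x = y) -> primary_noetherian H ->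
  primary_noetherian (q @` H).
Proof.
move=> qsurj [hH accH clH accP]; split.
- exact: is_submod_im.
- exact: acc_on_image.
- move=> y; have [x <-] := qsurj y; have [r [r0 xr]] := clH x.
  by exists r; split=> // t; rewrite -linear_ract; exists (x ** (t * r)).
move=> P maxP; apply: acc_on_sub (acc_on_image (f := q) _ (accP P maxP)); last first.
  exact: is_submod_primary_part.
move=> y [n yn]; have [x xy] := qsurj y.
have [a [k [Pa aP]]] := torsion_split_right maxP n hH (clH x).
have [h Hh hE] := yn _ Pa.
exists (x ** a + h); last first.
  rewrite linearD hE linear_ract xy -ractDr.
  by rewrite addrC subrK ract1.
exists k => p Pp; rewrite ractDl ractA; apply: is_submodD => //; first exact: aP.
exact: is_submodZ.
Qed.

Lemma stable_chain_descend (T : Type) (C : nat -> set T) n :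
  (forall k, C k.+2 `<=` C k.+1 -> C k.+1 `<=` C k) -> C n.+1 `<=` C n -> C 1%N `<=` C 0%N.
Proof. by move=> h; elim: n => [//|n IHn] /h. Qed.

(** A chain argument applied twice, to submodules with torsion-free quotient and
then inside each primary component. *)
Lemma primary_noetherian_bassian (M : lmodType R^c) (H : set M) :
  primary_noetherian H -> bassian M.
Proof.
move=> [hH accH clH accP] N [f finj].
pose p : {linear M -> quotient_module N} := proj N.
have p0 x : p x = 0 <-> x \in N by apply: proj_eq0.
pose step (A : set M) := [set y | exists x, A x /\ f x = p y].
have hstep A : is_submod A -> is_submod (step A).
  move=> hA; split; first by exists 0; rewrite !linear0; split=> //; apply: is_submod0.
  move=> a y y' [x [Ax fx]] [x' [Ax' fx']]; exists (a *: x + x').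
  by rewrite !linearP fx fx'; split=> //; apply: hA.2.
have step_mono A B : A `<=` B -> step A `<=` step B.
  by move=> AB y [x [Ax fx]]; exists x; split=> //; apply: AB.
have stepN A : is_submod A -> [set x | x \in N] `<=` step A.
  move=> hA y /p0 py; exists 0; rewrite linear0 py; split=> //; exact: is_submod0.
have h0 := @is_submod_zero _ M.
have h1 := is_submod_closure h0.
(* Chains of submodules [K] equal to their torsion closure stop, because such
   a [K] is determined by [K `&` H]. *)
have Ntors : [set x | x \in N] `<=` cl [set (0 : M)].
  pose C := fix C k := if k is j.+1 then cl (step (C j)) else cl [set (0 : M)].
  have hC k : is_submod (C k).
    by elim: k => [//|k IHk] /=; apply: is_submod_closure; apply: hstep.
  have CS k : C k `<=` C k.+1.
    elim: k => [|k IHk]; last by apply: closure_mono; apply: step_mono.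
    by apply: closure_mono => _ ->; apply: is_submod0; apply: hstep.
  have clC k : cl (C k) `<=` C k by case: k => [|k]; apply: closure_idem => //; apply: hstep.
  have [|||n nP] := @acc_on_chain _ _ H (fun k => C k `&` H) accH.
  - by move=> k; apply: is_submodI.
  - by move=> k x [].
  - by move=> k x [Cx Hx]; split=> //; apply: CS.
  apply: subset_trans (stable_chain_descend (C := C) (n := n) _ _).
  - by apply: subset_trans (stepN _ (hC 0%N)) _; apply: closure_sub; apply: hstep.
  - move=> k CC x Cx; have [y yE] := proj_surj (f x).
    have /CC[r [r0 yr]] : C k.+2 y.
      by apply: (closure_sub (hstep _ (hC k.+1))); exists x.
    apply: clC; exists r; split=> // t; have [z [Cz fz]] := yr t.
    have <- : z = x ** (t * r); last by [].
    apply: finj; by rewrite fz !linear_ract -yE.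
  - move=> x Cx; have [r [r0 xr]] := clH x; apply: clC; exists r; split=> // t.
    have [] // := nP n.+1 (leqnSn n) (x ** (t * r)); split=> //.
    by apply: is_submodZ.
(* To descend, an element of [f U] must be lifted to [U] itself; the part [y0 a] of
   a lift [y0] does it, since [N] is torsion. *)
have Nprim P : maximal_invertible_ideal iota P ->
    [set x | x \in N] `&` primary_part P [set (0 : M)] `<=` [set 0].
  move=> maxP; pose U := primary_part P [set (0 : M)].
  have hU : is_submod U by apply: is_submod_primary_part.
  pose C := fix C k := if k is j.+1 then step (C j) `&` U else [set (0 : M)].
  have hC k : is_submod (C k).
    by elim: k => [//|k IHk] /=; apply: is_submodI => //; apply: hstep.
  have CU k : C k `<=` U by case: k => [_ ->|k x []] //; apply: is_submod0.
  have CS k : C k `<=` C k.+1.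
    elim: k => [_ ->|k IHk x [sx Ux]]; first exact: is_submod0.
    by split=> //; apply: step_mono sx.
  have accU : acc_on U.
    apply: acc_on_sub (accP P maxP) => x [n xn]; exists n => q /xn ->.
    exact: is_submod0.
  have [n nP] := acc_on_chain accU hC CU CS.
  apply: subset_trans (stable_chain_descend (C := C) (n := n) _ _).
  - by move=> x [Nx Ux]; split=> //; apply: stepN.
  - move=> k CC x Cx; have [m xm] := CU _ _ Cx; have [y0 y0E] := proj_surj (f x).
    have Ny0 q : ideal_pow P m q -> y0 ** q \in N.
      by move=> /xm xq; apply/p0; rewrite linear_ract y0E -linear_ract [_ ** _]xq linear0.
    have tors_y0 : cl [set 0] y0.
      apply: closure_idem => //; apply: closure_mono Ntors _ _.
      have [_ [q [Pq q0]]] := ideal_pow_nonzero ded maxP m.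
      by exists q; split=> // t; apply: Ny0; apply: ideal_powMl.
    have [a [j [Pa aP]]] := torsion_split_right maxP m h0 tors_y0.
    have yE : p (y0 ** a) = f x.
      have /p0 : y0 ** (1 - a) \in N by apply: Ny0.
      by rewrite ractBr ract1 linearB -y0E => /eqP; rewrite subr_eq0 => /eqP.
    have Cy : C k.+2 (y0 ** a).
      by split; [exists x | exists j => q Pq; rewrite ractA; apply: aP].
    have [[z [Cz fz]] _] := CC _ Cy.
    by have <- : z = x by apply: finj; rewrite fz yE.
  - exact: nP.
move=> x Nx; apply/eqP; apply: contrapT => /negP x0.
have nzI := annihilator_mod_nonzero h0 (Ntors x Nx).
have [|P [maxP IP]] := exists_max_ideal ded nzI.
  by move=> /(_ 1); rewrite mul1r ract1 => /eqP; rewrite (negbTE x0).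
have [k [a [Pa aI]]] := coprime_right ded maxP nzI.
(* A nonzero [x] in [N] has a nonzero multiple [x t a] in a primary component:
   [a] does not annihilate [xR], because [P] contains the annihilator of [xR]
   but not [a]. *)
have [t xta] : exists t : R, x ** (t * a) <> 0.
  apply: contrapT => h; apply: (max_ideal_proper maxP).
  have /IP Pa' : annihilator_mod [set 0] x a.
    by move=> t; apply: contrapT => xta; apply: h; exists t.
  have [hP _] := ideal_two_sided P.
  by have := right_idealD hP Pa Pa'; rewrite subrK.
apply: xta; apply: (Nprim P maxP); split; first exact: rpredZ.
by exists k => q /aI /(_ t); rewrite ractA mulrA.
Qed.

(** * Torsion-free generators of a super Bassian module *)

Section SuperBassian.
Variable M : lmodType R^c.
Hypothesis sbM : super_bassian M.

(** The submodule generated by [y n] is isomorphic to the right ideal generated by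
[j n], hence torsion-free, and it is independent from the previous elements. *)
Definition free_at (y : nat -> M) (j : nat -> R) n : Prop :=
  [/\ j n != 0, forall r : R, lspan y n (y n ** r) -> j n * r = 0
    & forall r : R, j n * r = 0 -> y n ** r = 0].

Lemma free_comb y j n (c : nat -> R^c) : (forall i, (i < n)%N -> free_at y j i) ->
  comb y n c = 0 -> forall i, (i < n)%N -> j i * (c i : R) = 0.
Proof.
elim: n => // n IHn fr; rewrite /comb big_ord_recr /= => sum0.
have [jn yn ny] := fr n (ltnSn n).
have jc : j n * (c n : R) = 0.
  apply: yn; move/eqP: sum0; rewrite addrC addr_eq0 => /eqP->.
  by apply: is_submodN; [apply: is_submod_lspan | exists c].
move=> i; rewrite ltnS leq_eqVlt => /orP[/eqP->//|]; apply: IHn.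
  by move=> i' i_n; apply/fr/ltnW.
by move: sum0; rewrite (ny (c n)) // addr0.
Qed.

(** The [r] with [xr] in [A] form a right ideal that is not essential, otherwise
it would contain a nonzero ideal and [x] would be torsion modulo [A]. *)
Lemma free_extension (A : set M) x : is_submod A -> ~ cl A x ->
  exists j : R, j != 0 /\ forall r : R, A (x ** (j * r)) -> j * r = 0.
Proof.
move=> hA nx; apply: contrapT => h; apply: nx.
have [|r [r0 rP]] := essential_bounded hnpR npR (right_ideal_preim x hA); last by exists r.
move=> a a0; apply: contrapT => h'; apply: h; exists a; split=> // r Ar.
by apply/eqP; apply: contrapT => /negP ar; apply: h'; exists r.
Qed.

(** If [j = jp], then the ideal [I] generated by [j] satisfies [I <= IP], and
cancellation gives [P = R]. *)
Lemma not_fixed_mod_max_ideal P (j p : R) : maximal_invertible_ideal iota P ->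
  j != 0 -> p \in P -> j * (1 - p) != 0.
Proof.
move=> maxP j0 Pp; apply/eqP; rewrite mulrBr mulr1 => /eqP; rewrite subr_eq0 => /eqP jE.
apply: (max_ideal_proper maxP).
have [[tP Pl] _] := max_ideal_nonzero maxP.
pose I := [set x | forall K : set R, two_sided K -> K j -> K x].
have tI : two_sided I.
  split=> [|r x Ix K hK Kj]; last by apply: hK.2; apply: Ix.
  apply: right_idealP => [K [hK _] Kj|x y Ix Iy K hK Kj|x r Ix K hK Kj].
  - exact: right_ideal0.
  - by apply: right_idealD hK.1 (Ix K hK Kj) (Iy K hK Kj).
  - by apply: right_idealM hK.1 (Ix K hK Kj).
have Ij : I j by [].
apply: (cancel_left ded (I := I)) => //; first by split=> //; exists j.
move=> x; apply; last by rewrite jE; apply: product_mem.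
split=> [|r y hy K K0 KD KM].
  apply: right_idealP; [exact: product0 | by move=> ? ?; apply: productD |].
  move=> y r hy K K0 KD KM; apply: (hy [set y | K (y * r)]) => /=.
  - by rewrite mul0r.
  - by move=> a b Ka Kb; rewrite mulrDl; apply: KD.
  - by move=> a b Ia Pb; rewrite -mulrA; apply: KM => //; apply: ideal_mulr.
apply: (hy [set y | K (r * y)]) => /=.
- by rewrite mulr0.
- by move=> a b Ka Kb; rewrite mulrDr; apply: KD.
- by move=> a b Ia Pb; rewrite mulrA; apply: KM => //; apply: tI.2.
Qed.

(** Let [F] be the sum of the [y n R] and choose [K] with [K] and [F] intersecting
in [FP] and [F / FP] essential in [X = M / K]. Being an essential extension of
a module annihilated by [P], [X] is [P]-primary, hence noetherian as a quotient
of [M]. But the images of the [y n] are independent in [X]: otherwise some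
[j n (1 - p)] with [p] in [P] would be zero. *)
Lemma infinite_free_sequence y j : ~ (forall n, free_at y j n).
Proof.
move=> fr; have [I [nzI I1]] := exists_nonzero_proper_ideal npR nR.
have [P [maxP _]] := exists_max_ideal ded nzI I1.
have [[hP Pl] [p0 [Pp0 nzp0]]] := max_ideal_nonzero maxP.
pose F := [set x | exists n, lspan y n x].
have hF : is_submod F by apply: is_submod_lspan_union.
pose F' := [set x | exists n (c : nat -> R^c), (forall i, (c i : R) \in P) /\ x = comb y n c].
have hF' : is_submod F'.
  split=> [|a _ _ [n [c [Pc ->]]] [n' [c' [Pc' ->]]]].
    exists 0%N, (fun=> 0); rewrite /comb big_ord0; split=> // i.
    exact: (right_ideal0 hP).
  have [m [d [Pd dE]]] := @comb_linear _ M _ a n c n' c' hP Pc Pc'.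
  by exists m, d; split=> //; rewrite dE.
have [K [hK F'K KF maxK]] := pseudo_complement hF' hF.
pose X : lmodType R^c := quotient_module (set_submod hK).
pose q : {linear M -> X} := proj (set_submod hK).
have q0 x : q x = 0 <-> K x by rewrite proj_eq0; apply: in_set_submod.
have FP x p : F x -> p \in P -> K (x ** p).
  move=> [n [c ->]] Pp; apply: F'K; exists n, (fun i => (c i : R) * p); split.
    by move=> i; apply: Pl.
  by rewrite scaler_sumr; apply: eq_bigr => i _; rewrite ractA.
have hB : is_submod (q @` F) by apply: is_submod_im.
have BP (x : X) p : (q @` F) x -> p \in P -> x ** p = 0.
  by move=> [z Fz <-] Pp; rewrite -linear_ract; apply/q0/FP.
have essB (x : X) : x <> 0 -> exists r : R, (q @` F) (x ** r) /\ x ** r <> 0.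
  have [z <-] := proj_surj x => nz.
  have nK : ~ K z by move=> /q0.
  apply: contrapT => h; apply: nK; apply: maxK => r c Kc Fzc.
  apply: contrapT => nF'; apply: h; exists r.
  have qE : q (z ** r + c) = q z ** r.
    by rewrite linearD [X in _ + X](_ : _ = 0) ?addr0 ?linear_ract //; apply/q0.
  split; first by exists (z ** r + c).
  rewrite -[_ ** _]qE => /q0 Kzc; by apply: nF'; apply: KF.
have h0 := @is_submod_zero _ X.
have torsX (x : X) : cl [set 0] x.
  have B0 : [set 0] `<=` q @` F by move=> _ ->; apply: is_submod0.
  have [r [r0 rP]] := essential_bounded hnpR npR (right_ideal_preim x hB)
    (essential_colon h0 B0 essB x).
  have [s rsp] := prime_ring_elt prR r0 nzp0; exists (r * s * p0); split=> // t.
  by rewrite mulrA -ractA; apply: BP => //; rewrite mulrA -ractA; apply: is_submodZ hB (rP t).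
have prX : primary P X.
  move=> x; have [a1 [k1 [Pa1 a1P]]] := torsion_split_left maxP h0 (torsX x).
  have [a [k [Pa aP]]] := torsion_split_right maxP k1 h0 (torsX x).
  (* [x(1 - a)] is annihilated by an ideal comaximal with [P], so it generates a
     submodule with zero intersection with the essential submodule [q @` F]. *)
  exists k => p Pp; suff xa : x ** (1 - a) = 0 by rewrite (ract_fix xa) ractA aP.
  apply: contrapT => /essB[r [Bz]]; apply; rewrite (ract_fix (BP _ _ Bz Pa1)).
  by rewrite !ractA ?mulrA; apply: a1P.
have sbX : super_bassian X by apply: super_bassian_quotient.
have accX := primary_super_bassian_acc ded maxP prX sbX.
have [|||n nP] := @acc_on_chain _ X _ (fun n => lspan (fun i => q (y i)) n) accX.
- by move=> n; apply: is_submod_lspan.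
- by [].
- by move=> n; apply: lspan_le.
have [c cE] : lspan (fun i => q (y i)) n (q (y n)).
  by apply: (nP n.+1) => //; apply: lspan_mem.
pose z := \sum_(i < n) c i *: y i.
have [m [d [Pd yE]]] : F' (y n - z).
  apply: KF; split.
    apply/q0; rewrite linearB cE linear_sum; apply/eqP; rewrite subr_eq0; apply/eqP.
    by apply: eq_bigr => i _; rewrite linearZ.
  apply: is_submodB => //; first by exists n.+1; apply: lspan_mem.
  by exists n, c.
have lz : lspan y n z by exists c.
have hn := is_submod_lspan y n.
have [jn yn _] := fr n.
(* Terms of index greater than [n] vanish by freeness, those of smaller index
   belong to the span, and the one of index [n] is a multiple of [y n] by an
   element of [P]. *)
suff [p [Pp yp]] : exists p : R, p \in P /\ lspan y n (y n ** (1 - p)).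
  by have /eqP := not_fixed_mod_max_ideal maxP jn Pp; apply; apply: yn.
have {yE} : lspan y n (y n - comb y m d).
  by have -> : y n - comb y m d = z; rewrite // -yE subKr.
elim: m => [|m IHm].
  rewrite /comb big_ord0 subr0 => Hn; exists 0; rewrite subr0 ract1.
  by split=> //; apply: (right_ideal0 hP).
rewrite /comb big_ord_recr /= -/(comb y m d) opprD addrA => Hm.
have [m_n|n_m|mn] := ltngtP m n.
- apply: IHm; rewrite -[_ - _](subrK (d m *: y m)); apply: is_submodD => //.
  by apply: is_submodZ => //; apply: lspan_mem.
- apply: IHm; have [_ ym my] := fr m.
  suff ym0 : d m *: y m = 0 by move: Hm; rewrite ym0 subr0.
  have hm := is_submod_lspan y m.
  apply: (my (d m)); apply: (ym (d m)).
  rewrite -[d m *: y m](subKr (y n - comb y m d)).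
  apply: is_submodB => //; last exact: (lspan_le (ltnW n_m)).
  by apply: is_submodB => //; [apply: lspan_mem | exists d].
- subst m; exists (d n : R); split=> //; rewrite ractBr ract1.
  have -> : y n - d n *: y n = y n - comb y n d - d n *: y n + comb y n d.
    by rewrite [y n - comb y n d - _]addrAC subrK.
  by apply: is_submodD => //; exists d.
Qed.

End SuperBassian.

End Torsion.

(** * The two finiteness conditions and super Bassian modules *)

Section Characterization.
Variables (R : nzRingType) (Q : unitRingType) (iota : {rmorphism R -> Q}).
Hypothesis ded : dedekind_prime_ring iota.
Hypothesis npR : non_primitive R.
Variable M : lmodType R^c.

Let hnpR : hnp_ring R. Proof. by case: ded. Qed.
Let nR : noetherian R^c^o. Proof. by case: hnpR => _ []. Qed.
Let prR : prime_ring R. Proof. by case: hnpR. Qed.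

Local Notation cl := torsion_closure.

(** If no finite family worked, [free_extension] would give an infinite one. *)
Lemma exists_free_generators : super_bassian M ->
  exists (y : nat -> M) (j : nat -> R) n,
    (forall i, (i < n)%N -> free_at y j i) /\ forall x, cl (lspan y n) x.
Proof.
move=> sbM; apply: contrapT => h.
pose free (z : nat -> M * R) := free_at (fun i => (z i).1) (fun i => (z i).2).
have [|z z' n x zz' zP fr|z zP] := @greedy_sequence (M * R)%type (0, 0)
    (fun z n x => (forall i, (i < n)%N -> free z i) ->
     [/\ x.2 != 0, forall r : R, lspan (fun i => (z i).1) n (x.1 ** r) -> x.2 * r = 0
       & forall r : R, x.2 * r = 0 -> x.1 ** r = 0]).
- move=> z n; have [fr|nfr] := pselect (forall i, (i < n)%N -> free z i); last first.
    by exists (0, 0).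
  have [x nx] : exists x, ~ cl (lspan (fun i => (z i).1) n) x.
    apply: contrapT => h'; apply: h; exists (fun i => (z i).1), (fun i => (z i).2), n.
    by split=> // x; apply: contrapT => nx; apply: h'; exists x.
  have hl := is_submod_lspan (fun i => (z i).1) n.
  have [j [j0 jP]] := free_extension ded npR hl nx.
  exists (x ** j, j) => _; split=> // r /=; rewrite ractA; first exact: jP.
  by move=> ->; rewrite ract0.
- have lE i : (i <= n)%N -> lspan (fun i => (z i).1) i = lspan (fun i => (z' i).1) i.
    by move=> i_n; apply: lspan_ext => k ki; rewrite zz' //; apply: leq_trans i_n.
  rewrite -lE //; apply: zP => i i_n; have := fr i i_n.
  by rewrite /free /free_at -lE 1?ltnW // zz'.
have frz n : free z n.
  have [m] := ubnP n; elim: m n => // m IHm n nm; apply: zP => i i_n.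
  exact: (IHm i (leq_trans i_n nm)).
exact: (infinite_free_sequence ded npR sbM frz).
Qed.

(** If the nonzero ideal generated by [r] annihilates a combination of the [y i],
then each [j i * c i] annihilates it too, and primeness gives [j i * c i = 0]. *)
Lemma free_non_singular (y : nat -> M) j n (H : submodClosed M) :
  (forall x, x \in H <-> lspan y n x) -> (forall i, (i < n)%N -> free_at y j i) ->
  non_singular (submodule H).
Proof.
move=> HE fr; apply/seteqP; split=> [h|_ ->]; last first.
  apply/essential_idealP => a a0; exists 1; rewrite mulr1; split=> //=.
  exact: (scaler0 (submodule H)).
move=> /essential_idealP essh.
have hE : right_ideal [set r : R | (h : submodule H) ** r = 0].
  exact: (right_ideal_preim h (@is_submod_zero _ (submodule H))).
have [r [r0 rP]] := essential_bounded hnpR npR hE essh.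
apply: val_inj; rewrite linear0; have /HE[c cE] := valP h.
have ctr (t : R) : comb y n (fun i => (c i : R) * (t * r)) = 0.
  have /(congr1 val) := rP t; rewrite linear0 => <-.
  have -> : val (h ** (t * r)) = val h ** (t * r) by exact: linearZ.
  by rewrite cE scaler_sumr; apply: eq_bigr => i _; rewrite ractA.
rewrite cE big1 // => i _; have [_ _ ny] := fr i (ltn_ord i).
apply: (ny (c i)); apply/eqP; apply: contrapT => /negP jc.
have [s] := prime_ring_elt prR jc r0.
by have := free_comb fr (ctr s) (ltn_ord i); rewrite !mulrA => ->; rewrite eqxx.
Qed.

Lemma singular_quotientP (H : submodClosed M) :
  singular (quotient_module H) <-> forall x, cl [set x | x \in H] x.
Proof.
pose p : {linear M -> quotient_module H} := proj H.
have p0 x : p x = 0 <-> x \in H by apply: proj_eq0.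
split=> [singH x|clH].
  have : Sing (quotient_module H) (p x) by rewrite [Sing _]singH.
  move=> /essential_idealP ess.
  have hE := right_ideal_preim x (is_submod_mem H).
  apply: (essential_bounded hnpR npR hE) => a /ess[s [ps s0]]; exists s.
  by split=> //; apply/p0; rewrite linear_ract.
apply/seteqP; split=> // z _; apply/essential_idealP => a a0.
have [x <-] := proj_surj z; have [r [r0 rP]] := clH x.
have [s asr] := prime_ring_elt prR a0 r0; exists (s * r); rewrite mulrA; split=> //.
by have /p0 := rP (a * s); rewrite linear_ract.
Qed.

(** In the torsion module [X], the elements annihilated by an ideal comaximal with
[P] form a complement [N] of the primary component; so the component embeds
in the [P]-primary super Bassian module [X / N]. *)
Lemma super_bassian_primary_acc P (X : lmodType R^c) :
  maximal_invertible_ideal iota P -> super_bassian X ->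
  (forall x : X, cl [set 0] x) -> acc_on (@primary_part R X P [set 0]).
Proof.
move=> maxP sbX torsX; have h0 := @is_submod_zero _ X.
have [[hP Pl] _] := max_ideal_nonzero maxP.
pose N := [set x : X | exists a : R, 1 - a \in P /\ forall t : R, x ** (t * a) = 0].
have hN : is_submod N.
  split=> [|b x y [a [Pa xa]] [a' [Pa' ya']]].
    by exists 1; rewrite subrr; split=> [|t]; [apply: (right_ideal0 hP) | rewrite scaler0].
  exists (a * a'); split=> [|t].
    rewrite (_ : 1 - _ = (1 - a) + a * (1 - a')); last by rewrite mulrBr mulr1 addrA subrK.
    by apply: (right_idealD hP) => //; apply: Pl.
  rewrite ractDl ractA [X in _ + X](_ : _ = 0) ?addr0; last by rewrite mulrA ya'.
  by rewrite !mulrA -ractA xa scaler0.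
pose Y : lmodType R^c := quotient_module (set_submod hN).
pose p : {linear X -> Y} := proj (set_submod hN).
have p0 x : p x = 0 <-> N x by rewrite proj_eq0; apply: in_set_submod.
have prY : primary P Y.
  move=> y; have [x <-] := proj_surj y.
  have [a1 [k1 [Pa1 a1P]]] := torsion_split_left ded maxP h0 (torsX x).
  have [a [k [Pa aP]]] := torsion_split_right ded maxP k1 h0 (torsX x).
  have Nx : N (x ** (1 - a)).
    by exists a1; split=> // t; rewrite ractA mulrA; apply: a1P.
  have px : p x ** (1 - a) = 0 by rewrite -linear_ract; apply/p0.
  exists k => q Pq; rewrite (ract_fix px) ractA -[LHS]linear_ract.
  by rewrite [_ ** _](aP q Pq) linear0.
have sbY : super_bassian Y by apply: super_bassian_quotient.
have accY := primary_super_bassian_acc ded maxP prY sbY.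
apply: (@acc_on_ext _ _ _ p); first exact: is_submod_primary_part; last exact: acc_on_sub accY.
apply: acc_on_sub (@acc_on_lspan _ X (fun=> 0) 0 nR) => x [[n xn] /p0[a [Pa xa]]].
have [a' [Pa' [c ac] _]] := coprime_pow n Pa.
suff -> : x = 0 by apply: is_submod0; apply: is_submod_lspan.
have x1 : x ** (1 - a') = 0 by apply: xn.
by rewrite (ract_fix x1) ac xa.
Qed.

Lemma primary_componentP P (X : lmodType R^c) (x : X) :
  x \in primary_component P X <-> primary_part P [set 0] x.
Proof.
split=> [/asboolP[n [_ xn]]|[n xn]]; first by exists n.
by apply/asboolP; exists n.+1; split=> // r /ideal_powS; apply: xn.
Qed.

Lemma super_bassian_decomposition : super_bassian M ->
  exists H : submodClosed M,
    [/\ finitely_generated (submodule H), non_singular (submodule H),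
        singular (quotient_module H)
      & all_primary_components iota (@noetherian R^c) (quotient_module H)].
Proof.
move=> sbM; have [y [j [n [fr clH]]]] := exists_free_generators sbM.
pose H : submodClosed M := set_submod (is_submod_lspan y n).
have HE x : x \in H <-> lspan y n x by apply: in_set_submod.
have HE' : [set x | x \in H] = lspan y n by apply/seteqP; split=> x /HE.
have singH : singular (quotient_module H) by apply/singular_quotientP => x; rewrite HE'.
exists H; split=> //.
- by apply: fg_finitely_generated; exists y, n.
- exact: free_non_singular HE fr.
move=> P maxP; apply: acc_noetherian.
apply: acc_on_sub (super_bassian_primary_acc maxP (super_bassian_quotient (N := H) sbM) _).
  by move=> x /primary_componentP.
move=> z; have [x <-] := proj_surj z; have [r [r0 rP]] := clH x.
exists r; split=> // t; rewrite -linear_ract; apply/proj_eq0/HE; exact: rP.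
Qed.

Lemma super_bassian_of_decomposition (H : submodClosed M) :
  finitely_generated (submodule H) -> singular (quotient_module H) ->
  all_primary_components iota (@finitely_generated R^c) (quotient_module H) ->
  super_bassian M.
Proof.
move=> /finitely_generated_fg/(acc_on_of_fg nR) accH /singular_quotientP clH fgP.
move=> M' q qsurj; have hH := is_submod_mem H.
apply: (primary_noetherian_bassian ded (H := q @` [set x | x \in H])).
apply: primary_noetherian_image => //; split=> // P maxP.
pose p : {linear M -> quotient_module H} := proj H.
have p0 x : p x = 0 <-> x \in H by apply: proj_eq0.
apply: (acc_on_ext (f := p)); first exact: is_submod_primary_part.
  by apply: acc_on_sub accH => x [_ /p0].
have /finitely_generated_fg/(acc_on_of_fg nR) := fgP P maxP.
apply: acc_on_sub => _ [x [n xn] <-]; apply/primary_componentP; exists n => r Pr.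
by rewrite -linear_ract; apply/p0/xn.
Qed.

End Characterization.

Theorem theorem1p13 (R : nzRingType) (Q : unitRingType)
    (iota : {rmorphism R -> Q}) (M : lmodType R^c) :
  dedekind_prime_ring iota ->
  non_primitive R ->
  (super_bassian M <->
   exists H : submodClosed M,
     [/\ finitely_generated (submodule H),
         non_singular (submodule H),
         singular ((quotient_module H))
       & all_primary_components iota (@noetherian R^c) ((quotient_module H))]) /\
  (super_bassian M <->
   exists H : submodClosed M,
     [/\ finitely_generated (submodule H),
         singular ((quotient_module H))
       & all_primary_components iota (@finitely_generated R^c) ((quotient_module H))]).
Proof.
move=> ded npR.
have noeth_fg H : all_primary_components iota (@noetherian R^c) (quotient_module H) ->
    all_primary_components iota (@finitely_generated R^c) (quotient_module H).
  by move=> noethH P maxP; apply: noetherian_finitely_generated; apply: noethH.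
split; split.
- exact: super_bassian_decomposition.
- by move=> [H [fgH _ sH /noeth_fg]]; apply: super_bassian_of_decomposition.
- by move=> /(super_bassian_decomposition ded npR)[H [fgH _ sH /noeth_fg fgP]]; exists H.
- by move=> [H [fgH sH fgP]]; apply: super_bassian_of_decomposition fgP.
Qed.
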